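(* Let $p\ge 1$, $\Lambda>0$, and let $\varrho_0\in\mathscr{P}(\mathbb{R}^d)$ have compact support. Let $\nu_\star$ be a minimizer of the relaxed problem $$\inf_{\nu\in\mathscr{P}_p(\mathbb{R}^d)} W_p^p(\varrho_0,\nu)+\Lambda\,\mathcal{L}(\nu),$$ and let $\Sigma=\operatorname{supp}\nu_\star$. Suppose that there is a measurable selection $\pi_\Sigma$, defined $\varrho_0$-a.e., of the projection multimap $\Pi_\Sigma(x)=\operatorname{argmin}_{y\in\Sigma}\frac12|x-y|^2$, i.e. a measurable map with $\pi_\Sigma(x)\in\Pi_\Sigma(x)$ for $\varrho_0$-a.e. $x$. If $\gamma$ is an optimal transportation plan between $\varrho_0$ and $\nu_\star$ (for the cost $|x-y|^p$) and $\Gamma\subset\Sigma$ is a loop, then $$|x-y|=\operatorname{dist}(x,\Sigma)\quad\text{for } \gamma\text{-a.e. } (x,y)\in\mathbb{R}^d\times\Gamma.$$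
   Context: $\mathscr{P}_p(\mathbb{R}^d)$ is the set of Borel probability measures on $\mathbb{R}^d$ with finite $p$-th moment. $W_p^p(\mu,\nu)=\min_{\gamma\in\Pi(\mu,\nu)}\int |x-y|^p\,d\gamma(x,y)$, with $\Pi(\mu,\nu)$ the couplings of $\mu$ and $\nu$; a minimizer is an optimal transportation plan. $\mathscr{H}^1$ is the one-dimensional Hausdorff measure and $\mu\llcorner A(B)=\mu(A\cap B)$. Length functional: for $\nu\in\mathscr{P}(\mathbb{R}^d)$, if $\operatorname{supp}\nu$ is connected then $$\mathcal{L}(\nu)=\min\{\alpha\ge 0:\ \alpha\nu\ge \mathscr{H}^1\llcorner\operatorname{supp}\nu\}$$ (with value $+\infty$ if no such $\alpha$ exists), and $\mathcal{L}(\nu)=+\infty$ otherwise. A loop is a set homeomorphic to $\mathbb{S}^1$. *)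

(* Defs.v *)
From HB Require Import structures.
From mathcomp Require Import all_boot all_order all_algebra.
From mathcomp Require Import all_classical all_reals all_analysis.

Set Implicit Arguments.
Unset Strict Implicit.
Unset Printing Implicit Defensive.

Import Order.TTheory GRing.Theory Num.Theory.
Import numFieldNormedType.Exports.

Local Open Scope classical_set_scope.
Local Open Scope ring_scope.

(* The norm that the library puts on 'rV[R]_d is the sup norm: it induces the
   usual topology, but distances have to be measured with the Euclidean norm. *)
Definition eucl_norm (R : realType) (d : nat) (x : 'rV[R]_d) : R :=
  Num.sqrt (\sum_(i < d) x ord0 i ^+ 2).

Definition eucl_dist (R : realType) (d : nat) (x y : 'rV[R]_d) : R := eucl_norm (x - y).

Definition dist_set (R : realType) (d : nat) (x : 'rV[R]_d)
    (A : set 'rV[R]_d) : R :=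
  inf [set eucl_dist x y | y in A].

(* The type 'rV[R]_d equipped with its Borel sigma-algebra. *)
Notation borel R d := (g_sigma_algebraType (@open 'rV[R]_d)).

Section Measures.
Context (R : realType) (d : nat).
Local Open Scope ereal_scope.

Definition supp (mu : probability (borel R d) R) : set 'rV[R]_d :=
  [set x | forall U : set 'rV[R]_d, open U -> U x -> 0 < mu U].

Definition finite_moment (p : R) (mu : probability (borel R d) R) : Prop :=
  \int[mu]_x (eucl_norm x `^ p)%:E < +oo.

Definition coupling (mu nu : probability (borel R d) R)
    (gamma : probability (borel R d * borel R d)%type R) : Prop :=
  (forall A : set (borel R d), measurable A -> gamma (A `*` setT) = mu A) /\
  (forall B : set (borel R d), measurable B -> gamma (setT `*` B) = nu B).

Definition transport_cost (p : R)
    (gamma : probability (borel R d * borel R d)%type R) : \bar R :=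
  \int[gamma]_z (eucl_dist z.1 z.2 `^ p)%:E.

(* The minimum over couplings is always attained, so it is this infimum. *)
Definition wasserstein_pow (p : R) (mu nu : probability (borel R d) R) :
    \bar R :=
  ereal_inf [set transport_cost p gamma | gamma in coupling mu nu].

Definition optimal_plan (p : R) (mu nu : probability (borel R d) R)
    (gamma : probability (borel R d * borel R d)%type R) : Prop :=
  coupling mu nu gamma /\
  forall gamma' : probability (borel R d * borel R d)%type R,
    coupling mu nu gamma' -> transport_cost p gamma <= transport_cost p gamma'.

(* The adjoined 0 makes the diameter of the empty set equal to 0. *)
Definition diameter (A : set 'rV[R]_d) : \bar R :=
  ereal_sup (0 |` [set (eucl_dist x y)%:E | x in A & y in A]).

Definition hausdorff1_pre (delta : R) (A : set 'rV[R]_d) : \bar R :=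
  ereal_inf [set \sum_(0 <= i <oo) diameter (U i) | U in
    [set U : (set 'rV[R]_d)^nat |
      A `<=` \bigcup_i U i /\ forall i, diameter (U i) <= delta%:E]].

(* In dimension one the usual normalising factor omega_1 / 2 is 1. *)
Definition hausdorff1 (A : set 'rV[R]_d) : \bar R :=
  ereal_sup [set hausdorff1_pre delta A | delta in [set delta | (0 < delta)%R]].

Definition length_bound (nu : probability (borel R d) R) (a : R) : Prop :=
  (0 <= a)%R /\ forall B : set (borel R d), measurable B ->
    hausdorff1 (supp nu `&` B) <= a%:E * nu B.

(* The infimum is a minimum as soon as the set is nonempty, see
   length_functional_min. *)
Definition length_functional (nu : probability (borel R d) R) : \bar R :=
  if `[< connected (supp nu) >] then
    ereal_inf [set a%:E | a in length_bound nu]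
  else +oo.

Definition relaxed_energy (p Lambda : R) (rho nu : probability (borel R d) R) :
    \bar R :=
  wasserstein_pow p rho nu + Lambda%:E * length_functional nu.

Definition relaxed_minimizer (p Lambda : R)
    (rho nu : probability (borel R d) R) : Prop :=
  finite_moment p nu /\
  forall nu' : probability (borel R d) R, finite_moment p nu' ->
    relaxed_energy p Lambda rho nu <= relaxed_energy p Lambda rho nu'.

End Measures.

Definition argmin_dist (R : realType) (d : nat) (A : set 'rV[R]_d)
    (x : 'rV[R]_d) : set 'rV[R]_d :=
  [set y | A y /\
    forall z, A z -> 2^-1 * eucl_dist x y ^+ 2 <= 2^-1 * eucl_dist x z ^+ 2].

(* f is only meaningful on the conull set D, hence it is defined mu-a.e. *)
Definition measurable_selection_ae (R : realType) (d : nat)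
    (mu : probability (borel R d) R) (F : 'rV[R]_d -> set 'rV[R]_d)
    (f : borel R d -> borel R d) : Prop :=
  exists D : set (borel R d),
    [/\ measurable D, mu (~` D) = 0%E, measurable_fun D f &
        {ae mu, forall x, D x -> F x (f x)}].

Definition homeomorphic (T U : topologicalType) (A : set T) (B : set U) : Prop :=
  exists (f : T -> U) (g : U -> T),
    [/\ {within A, continuous f}, {within B, continuous g},
        set_fun A B f, set_fun B A g &
        {in A, cancel f g} /\ {in B, cancel g f}].

Definition circle (R : realType) : set 'rV[R]_2 := [set z | eucl_norm z = 1].

Definition loop (R : realType) (d : nat) (G : set 'rV[R]_d) : Prop :=
  homeomorphic (@circle R) G.

Lemma length_functional_min (R : realType) (d : nat)
    (nu : probability (borel R d) R) :
  connected (supp nu) -> length_bound nu !=set0 ->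
  exists2 a : R, length_bound nu a & length_functional nu = a%:E.
Proof.
move=> cnu [a0 a0P]; rewrite /length_functional asboolT//.
have hlb : has_inf (length_bound nu).
  by split; [exists a0|exists 0 => a []].
exists (inf (length_bound nu)); last first.
  by apply: ereal_inf_EFin; [exact: (proj2 hlb)|exact: (proj1 hlb)].
split; first by apply: lb_le_inf; [exists a0|move=> a []].
move=> B mB; apply/lee_addgt0Pr => e e0.
have [a aL alt] := inf_adherent e0 hlb.
apply: (le_trans (proj2 aL B mB)).
have fB : (nu B \is a fin_num)%E by exact: fin_num_measure.
have B1 : (fine (nu B) <= 1)%R.
  by rewrite -lee_fin fineK//; exact: probability_le1.
have B0 : (0 <= fine (nu B))%R by apply: fine_ge0.
rewrite -(fineK fB) -!EFinM -EFinD lee_fin.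
apply: le_trans (ler_wpM2r B0 (ltW alt)) _.
by rewrite mulrDl lerD2l ler_piMr// ltW.
Qed.

(* Main.v *)
Require Import Defs.
From HB Require Import structures.
From mathcomp Require Import all_boot all_order all_algebra.
From mathcomp Require Import all_classical all_reals all_analysis measurable_realfun.
From mathcomp Require Import ring lra.

(** Write S for the support of the minimizer nu, a for a real number with
    a nu >= H^1 restricted to S, and c(x, y) = |x - y|^p.  Only pairs (x, y) with
    y on the loop and c(x, y) >= dist(x, S)^p + eps, for some eps > 0, can
    violate the conclusion; let m(B) be the gamma-mass of such pairs with y in
    B.  The claim is that m vanishes on the loop, for each eps.

    Everything is drawn from one family of competitors.  Choose a closed
    connected S' inside S, not reduced to a point, a Borel set G such that S minus G
    is contained in S' and S' meets G in an H^1-null set, and a point q of S' from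
    which every point of S outside S' is at distance at most delta <= 1.  Keep all the mass of gamma that goes outside G, and
    send a pair (x, y) with y in G to (x, pi(x)) if pi(x) lies in S', to (x, q)
    otherwise.  The new second marginal has support S' and still satisfies the
    length bound with the same constants, so the length functional does not
    increase; hence the transport cost cannot decrease.  The rerouted mass pays at
    most (dist(x, S) + delta)^p, and dist(x, S) is bounded for rho0-a.e. x, so that
    m(G) <= kappa delta nu(G) for a constant kappa (excess_bound).

    With S' = S, G a point and delta = 0 this says that m has no atoms on S
    (atomless_on_supp): the part of nu that is not needed for the length is free to
    move.  The other competitors cut the loop.  Let D be an open arc of the loop, C
    the component of S minus D that contains the rest of the loop, and take for S'
    the closure of C.  Three facts make this work.
    - S minus C (the arc and the branches hanging on it) is connected and has an
      endpoint q of D in its closure.  A connected set is at most as wide as its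
      H^1 measure, so its points are at distance at most a nu(S minus C)
      from q (arc_rest_dist).
    - The closure of C may meet D, but only in an H^1-null set: near such a point
      the connected set C, which avoids D, has length at least r in the ball of
      radius r, and a packing argument concludes (arc_rest_closure_null).
    - Disjoint arcs yield disjoint sets S minus C (arc_rest_disjoint).
    Consequently m(K) <= kappa a nu(S minus C)^2 for closed arcs K inside
    D (arc_removal_bound).

    Since m is atomless on the loop, each half loop, of mass M say, can be
    divided into 3n arcs of mass M / (3n).  Group them three by three: the
    union of each group is an arc D, and its middle third is K.  The n sets
    S minus C are disjoint, thus one of them has nu-mass at most 1 / n, and
    M / (3n) <= kappa a / n^2.  Letting n grow gives M = 0 (half_loop_null). *)

Set Implicit Arguments.
Unset Strict Implicit.
Unset Printing Implicit Defensive.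

Import Order.TTheory GRing.Theory Num.Theory.
Import numFieldNormedType.Exports.

Local Open Scope classical_set_scope.
Local Open Scope ring_scope.

(** * Euclidean distance *)

Lemma eucl_norm_ge0 (R : realType) d (x : 'rV[R]_d) : 0 <= eucl_norm x.
Proof. exact: sqrtr_ge0. Qed.

Lemma sqr_eucl_norm (R : realType) d (x : 'rV[R]_d) :
  eucl_norm x ^+ 2 = \sum_(i < d) x ord0 i ^+ 2.
Proof. by rewrite sqr_sqrtr// sumr_ge0// => i _; exact: sqr_ge0. Qed.

Lemma eucl_norm0 (R : realType) d : eucl_norm (0 : 'rV[R]_d) = 0.
Proof.
by rewrite /eucl_norm big1 ?sqrtr0// => i _; rewrite mxE expr0n.
Qed.

Lemma eucl_normN (R : realType) d (x : 'rV[R]_d) : eucl_norm (- x) = eucl_norm x.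
Proof. by congr Num.sqrt; apply: eq_bigr => i _; rewrite mxE sqrrN. Qed.

Lemma ler_coord_eucl_norm (R : realType) d (x : 'rV[R]_d) i :
  `|x ord0 i| <= eucl_norm x.
Proof.
rewrite -sqrtr_sqr ler_sqrt; last by rewrite sumr_ge0// => j _; exact: sqr_ge0.
by rewrite (bigD1 i)//= lerDl sumr_ge0// => j _; exact: sqr_ge0.
Qed.

(** Cauchy-Schwarz: after multiplication by 2 |x| |y|, it is the sum over the
    coordinates of the inequalities (|y| x_i - |x| y_i)^2 >= 0. *)
Lemma dot_le_eucl_norm (R : realType) d (x y : 'rV[R]_d) :
  \sum_(i < d) x ord0 i * y ord0 i <= eucl_norm x * eucl_norm y.
Proof.
set a := eucl_norm x; set b := eucl_norm y.
have a0 : 0 <= a by exact: eucl_norm_ge0.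
have b0 : 0 <= b by exact: eucl_norm_ge0.
have [a_eq0|aN0] := eqVneq a 0.
  rewrite a_eq0 mul0r big1// => i _.
  have := ler_coord_eucl_norm x i; rewrite -/a a_eq0 normr_le0 => /eqP ->.
  by rewrite mul0r.
have [b_eq0|bN0] := eqVneq b 0.
  rewrite b_eq0 mulr0 big1// => i _.
  have := ler_coord_eucl_norm y i; rewrite -/b b_eq0 normr_le0 => /eqP ->.
  by rewrite mulr0.
have ab0 : 0 < a * b by rewrite mulr_gt0// lt_neqAle eq_sym ?aN0 ?bN0.
rewrite -(ler_pM2l ab0).
suff : \sum_(i < d) 2 * (a * b * (x ord0 i * y ord0 i)) <=
       2 * (a * b * (a * b)).
  by move=> h; rewrite -!mulr_sumr ler_pM2l in h.
have -> : 2 * (a * b * (a * b)) =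
    \sum_(i < d) (b ^+ 2 * x ord0 i ^+ 2 + a ^+ 2 * y ord0 i ^+ 2).
  rewrite big_split/= -!mulr_sumr -!sqr_eucl_norm -/a -/b; ring.
apply: ler_sum => i _; rewrite -subr_ge0.
set u := x _ _; set v := y _ _.
rewrite (_ : _ - _ = (b * u - a * v) ^+ 2) ?sqr_ge0//; ring.
Qed.

Lemma ler_eucl_normD (R : realType) d (x y : 'rV[R]_d) :
  eucl_norm (x + y) <= eucl_norm x + eucl_norm y.
Proof.
rewrite -(@ler_pXn2r _ 2) ?nnegrE ?eucl_norm_ge0 ?addr_ge0 ?eucl_norm_ge0//.
rewrite sqrrD !sqr_eucl_norm.
have -> : \sum_(i < d) (x + y) ord0 i ^+ 2 = \sum_(i < d) x ord0 i ^+ 2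
    + (\sum_(i < d) x ord0 i * y ord0 i) *+ 2 + \sum_(i < d) y ord0 i ^+ 2.
  rewrite -sumrMnl -!big_split/=; apply: eq_bigr => i _.
  by rewrite mxE sqrrD.
by rewrite lerD2r lerD2l lerMn2r dot_le_eucl_norm.
Qed.

Lemma eucl_dist_ge0 (R : realType) d (x y : 'rV[R]_d) : 0 <= eucl_dist x y.
Proof. exact: eucl_norm_ge0. Qed.

Lemma eucl_distxx (R : realType) d (x : 'rV[R]_d) : eucl_dist x x = 0.
Proof. by rewrite /eucl_dist subrr eucl_norm0. Qed.

Lemma eucl_distC (R : realType) d (x y : 'rV[R]_d) : eucl_dist x y = eucl_dist y x.
Proof. by rewrite /eucl_dist -eucl_normN opprB. Qed.

Lemma eucl_distD (R : realType) d (y x z : 'rV[R]_d) :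
  eucl_dist x z <= eucl_dist x y + eucl_dist y z.
Proof.
rewrite /eucl_dist; have -> : x - z = (x - y) + (y - z) by rewrite addrA subrK.
exact: ler_eucl_normD.
Qed.

Lemma eucl_dist_eq0 (R : realType) d (x y : 'rV[R]_d) :
  eucl_dist x y = 0 -> x = y.
Proof.
move=> xy0; apply/rowP => i.
have := ler_coord_eucl_norm (x - y) i.
rewrite -/(eucl_dist x y) xy0 normr_le0 !mxE subr_eq0.
by move=> /eqP.
Qed.

Lemma eucl_dist_gt0 (R : realType) d (x y : 'rV[R]_d) :
  x <> y -> 0 < eucl_dist x y.
Proof.
move=> xy; rewrite lt_neqAle eucl_dist_ge0 andbT; apply/negP => /eqP/esym.
by move=> /eucl_dist_eq0.
Qed.

Lemma eucl_dist_lip (R : realType) d (x y z : 'rV[R]_d) :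
  `|eucl_dist x y - eucl_dist x z| <= eucl_dist y z.
Proof.
rewrite ler_norml lerBlDr (eucl_distC y z) (addrC (eucl_dist z y)) eucl_distD andbT.
by rewrite lerBrDr addrC lerBlDr (eucl_distC z y) eucl_distD.
Qed.

Lemma norm_le_eucl_norm (R : realType) d (x : 'rV[R]_d) : `|x| <= eucl_norm x.
Proof.
rewrite [leLHS]mx_normrE; apply: bigmax_le; first exact: eucl_norm_ge0.
by move=> [i j] _ /=; rewrite ord1; exact: ler_coord_eucl_norm.
Qed.

Lemma continuous_eucl_norm (R : realType) d : continuous (@eucl_norm R d).
Proof.
move=> x; apply: (@continuous_comp _ _ _
  (fun x : 'rV[R]_d => \sum_(i < d) x ord0 i ^+ 2) Num.sqrt);
  last exact: sqrt_continuous.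
move: x; apply: continuous_big => [|i _ x]; first exact: add_continuous.
by apply: (@continuous_comp _ _ _ (fun x : 'rV[R]_d => x ord0 i) (fun y => y ^+ 2));
  [exact: coord_continuous|exact: exprn_continuous].
Qed.

Lemma continuous_eucl_dist (R : realType) d (x : 'rV[R]_d) :
  continuous (eucl_dist x).
Proof.
rewrite (_ : eucl_dist x = @eucl_norm R d \o (fun y => x - y))// => y.
apply: continuous_comp; last exact: continuous_eucl_norm.
by apply: (@continuousB _ _ _ (fun=> x) id); [exact: cst_continuous|].
Qed.

(** On row vectors [ball] refers to the sup norm. *)
Definition eball (R : realType) d (x : 'rV[R]_d) (r : R) : set 'rV[R]_d :=
  [set y | eucl_dist x y < r].

Lemma open_eball (R : realType) d (x : 'rV[R]_d) r : open (eball x r).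
Proof.
rewrite (_ : eball x r = eucl_dist x @^-1` [set t | t < r])//.
by apply: open_comp; [move=> y _; exact: continuous_eucl_dist|exact: open_lt].
Qed.

Lemma eball_center (R : realType) d (x : 'rV[R]_d) r : 0 < r -> eball x r x.
Proof. by rewrite /eball/= eucl_distxx. Qed.

Lemma nbhs_eball (R : realType) d (x : 'rV[R]_d) r : 0 < r -> nbhs x (eball x r).
Proof.
by move=> r0; apply: open_nbhs_nbhs; split; [exact: open_eball|exact: eball_center].
Qed.

Lemma open_sub_eball (R : realType) d (x : 'rV[R]_d) (U : set 'rV[R]_d) :
  open U -> U x -> exists2 r, 0 < r & eball x r `<=` U.
Proof.
move=> oU Ux; have /nbhs_ballP[r r0 rU] : nbhs x U.
  by apply: open_nbhs_nbhs; split.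
exists r => // y xyr; apply: rU; rewrite -ball_normE/=.
by apply: le_lt_trans xyr; exact: norm_le_eucl_norm.
Qed.

Lemma closure_eball (R : realType) d (A : set 'rV[R]_d) x :
  closure A x <-> forall r, 0 < r -> exists2 y, A y & eucl_dist x y < r.
Proof.
split=> [clAx r r0|Ar U].
  by have [y [Ay xy]] := clAx _ (nbhs_eball x r0); exists y.
rewrite nbhsE => -[V [oV Vx] VU].
have [r r0 rV] := open_sub_eball oV Vx.
have [y Ay xy] := Ar _ r0; exists y; split => //; apply/VU/rV/xy.
Qed.

Lemma invr_boundS_lt (R : realType) (e : R) :
  0 < e -> (Num.bound e^-1).+1%:R^-1 < e.
Proof.
move=> e0; rewrite -[ltRHS]invrK ltf_pV2 ?posrE ?invr_gt0//.
by rewrite (lt_le_trans (archi_boundP _))// ?invr_ge0 ?ltW// ltr_nat.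
Qed.

Lemma closed_point (R : realType) d (y : 'rV[R]_d) : closed [set y].
Proof.
by apply: compact_closed; [exact: norm_hausdorff|exact: compact_set1].
Qed.

(** * One-dimensional Hausdorff measure *)

Lemma diameter_ge0 (R : realType) d (A : set 'rV[R]_d) : (0 <= diameter A)%E.
Proof. by apply: ereal_sup_ubound; left. Qed.

Lemma eucl_dist_le_diameter (R : realType) d (A : set 'rV[R]_d) x y :
  A x -> A y -> ((eucl_dist x y)%:E <= diameter A)%E.
Proof. by move=> Ax Ay; apply: ereal_sup_ubound; right; exists x => //; exists y. Qed.

Lemma diameter_le (R : realType) d (A : set 'rV[R]_d) (r : R) : 0 <= r ->
  (forall x y, A x -> A y -> eucl_dist x y <= r) -> (diameter A <= r%:E)%E.
Proof.
move=> r0 Ar; apply: ge_ereal_sup => _ [->|[x Ax [y Ay <-]]]; rewrite lee_fin//.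
exact: Ar.
Qed.

Lemma diameter0 (R : realType) d : diameter (@set0 'rV[R]_d) = 0%E.
Proof. by apply/eqP; rewrite eq_le diameter_ge0 diameter_le. Qed.

Lemma hausdorff1_pre_le (R : realType) d (A B : set 'rV[R]_d) (delta : R) :
  A `<=` B -> (hausdorff1_pre delta A <= hausdorff1_pre delta B)%E.
Proof.
move=> AB; apply: le_ereal_inf => _ [U [BU dU] <-].
by exists U => //; split => //; exact: subset_trans BU.
Qed.

Lemma hausdorff1_le (R : realType) d (A B : set 'rV[R]_d) :
  A `<=` B -> (hausdorff1 A <= hausdorff1 B)%E.
Proof.
move=> AB; apply: ge_ereal_sup => _ [delta delta0 <-].
apply: le_trans (hausdorff1_pre_le _ AB) _.
by apply: ereal_sup_ubound; exists delta.
Qed.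

Lemma hausdorff1_pre_ge0 (R : realType) d (A : set 'rV[R]_d) (delta : R) :
  (0 <= hausdorff1_pre delta A)%E.
Proof.
by apply: le_ereal_inf_tmp => _ [U _ <-]; apply: nneseries_ge0 => *; exact: diameter_ge0.
Qed.

Lemma hausdorff1_ge0 (R : realType) d (A : set 'rV[R]_d) : (0 <= hausdorff1 A)%E.
Proof.
apply: le_trans (hausdorff1_pre_ge0 A 1) _.
by apply: ereal_sup_ubound; exists 1 => //=.
Qed.

(** A set of diameter at most delta is mapped into a compact interval of length
    at most delta, so a cover of [A] gives a cover of the interval [0, r] by sets
    whose Lebesgue measures are bounded by the diameters. *)
Lemma hausdorff1_lipschitz (R : realType) d (A : set 'rV[R]_d)
    (f : 'rV[R]_d -> R) (r : R) :
  (forall x y, `|f x - f y| <= eucl_dist x y) -> `]0, r[ `<=` f @` A ->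
  (r%:E <= hausdorff1 A)%E.
Proof.
move=> lipf fA; have [r0|r0] := leP r 0.
  by apply: le_trans (hausdorff1_ge0 A); rewrite lee_fin.
apply: (@le_trans _ _ (hausdorff1_pre 1 A)); last first.
  by apply: ereal_sup_ubound; exists 1 => //=.
apply: le_ereal_inf_tmp => _ [U [AU dU] <-].
(* the convex hull of the image of [U n], measurable whatever [U n] is *)
pose I n : set R := if pselect (U n !=set0) is left _ then
  `[inf (f @` U n), sup (f @` U n)]%classic else set0.
have diam_fin n : diameter (U n) \is a fin_num.
  rewrite ge0_fin_numE; last exact: diameter_ge0.
  exact: le_lt_trans (dU n) (ltry _).
have fU n x y : U n x -> U n y -> f x <= f y + fine (diameter (U n)).
  move=> Ux Uy; rewrite -lerBlDl.
  apply: le_trans (ler_norm _) (le_trans (lipf _ _) _).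
  by rewrite -lee_fin fineK//; exact: eucl_dist_le_diameter.
have fUub n x : U n x -> has_ubound (f @` U n).
  move=> Ux; exists (f x + fine (diameter (U n))) => _ [y Uy <-]; exact: fU.
have fUlb n x : U n x -> has_lbound (f @` U n).
  move=> Ux; exists (f x - fine (diameter (U n))) => _ [y Uy <-].
  by rewrite lerBlDr; exact: fU.
have mI n : measurable (I n).
  by rewrite /I; case: pselect => // _; exact: measurable_itv.
have fUI n x : U n x -> I n (f x).
  move=> Ux; rewrite /I; case: pselect => [_|[]]; last by exists x.
  rewrite /= in_itv/=; apply/andP; split.
    by apply: ge_inf; [exact: fUlb Ux|exists x].
  by apply: ub_le_sup; [exact: fUub Ux|exists x].
have lamI n : (lebesgue_measure (I n) <= diameter (U n))%E.
  rewrite /I; case: pselect => [[x Ux]|_]; last by rewrite measure0 diameter_ge0.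
  rewrite lebesgue_measure_itv/= lte_fin.
  case: ifPn => // _; last exact: diameter_ge0.
  rewrite -EFinD -(fineK (diam_fin n)) lee_fin lerBlDr.
  apply: ge_sup; first by exists (f x), x.
  move=> _ [y Uy <-]; rewrite addrC -lerBlDr.
  apply: lb_le_inf; first by exists (f x), x.
  by move=> _ [z Uz <-]; rewrite lerBlDr; exact: fU.
apply: (@le_trans _ _ (\sum_(0 <= n <oo) lebesgue_measure (I n))%E); last first.
  by apply: lee_nneseries => // n _; exact: lamI.
have -> : r%:E = lebesgue_measure (`]0, r[%classic : set R).
  by rewrite lebesgue_measure_itv/= lte_fin r0 oppr0 adde0.
apply: measure_sigma_subadditive => //.
move=> t /fA[x Ax <-]; have [n _ Ux] := AU _ Ax.
by exists n => //; exact: fUI.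
Qed.

Lemma nneseries_interleave (R : realType) (u v : nat -> \bar R) :
  (forall n, 0 <= u n)%E -> (forall n, 0 <= v n)%E ->
  (\sum_(0 <= n <oo) (if odd n then v n./2 else u n./2) <=
   \sum_(0 <= n <oo) u n + \sum_(0 <= n <oo) v n)%E.
Proof.
move=> u0 v0; set w := fun n => if odd n then v n./2 else u n./2.
have w0 n : (0 <= w n)%E by rewrite /w; case: ifP.
apply: lime_le; first by apply: is_cvg_nneseries => n _ _; exact: w0.
apply: nearW => n.
apply: (@le_trans _ _ (\sum_(0 <= k < n.*2) w k)%E).
  rewrite -addnn [leRHS](@big_cat_nat _ _ _ n)//= ?leq_addr//.
  by apply: leeDl; apply: sume_ge0.
have -> : (\sum_(0 <= k < n.*2) w k =
    \sum_(0 <= k < n) u k + \sum_(0 <= k < n) v k)%E.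
  elim: n => [|n IH]; first by rewrite !big_geq// adde0.
  rewrite doubleS !big_nat_recr//= IH /w/= odd_double/= uphalf_double doubleK.
  by rewrite !addeA; congr (_ + _)%E; rewrite -!addeA; congr (_ + _)%E; rewrite addeC.
by apply: leeD; apply: nneseries_lim_ge.
Qed.

(** A cover of [A] and a cover of [N] of small total diameter are interleaved
    into one cover of the union. *)
Lemma hausdorff1_setU_null (R : realType) d (A N : set 'rV[R]_d) :
  hausdorff1 N = 0%E -> (hausdorff1 (A `|` N) <= hausdorff1 A)%E.
Proof.
move=> N0; apply: ge_ereal_sup => _ [delta delta0 <-].
apply: (@le_trans _ _ (hausdorff1_pre delta A)); last first.
  by apply: ereal_sup_ubound; exists delta.
have N0' : hausdorff1_pre delta N = 0%E.
  apply/eqP; rewrite eq_le hausdorff1_pre_ge0 andbT -N0.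
  by apply: ereal_sup_ubound; exists delta.
apply: le_ereal_inf_tmp => _ [U [AU dU] <-].
apply/lee_addgt0Pr => e e0.
have : (hausdorff1_pre delta N < e%:E)%E by rewrite N0' lte_fin.
move=> /ereal_inf_lt[_ [V [NV dV] <-] Ve].
apply: le_trans (leeD2l _ (ltW Ve)).
apply: le_trans (nneseries_interleave _ _);
  [|by move=> ?; exact: diameter_ge0|by move=> ?; exact: diameter_ge0].
apply: ereal_inf_lbound; exists (fun n => if odd n then V n./2 else U n./2).
  split=> [x [/AU|/NV][n _ Wx]|n].
  - by exists n.*2 => //; rewrite odd_double doubleK.
  - by exists n.*2.+1 => //=; rewrite odd_double/= uphalf_double.
  - by case: ifP.
by apply: eq_eseriesr => n _; case: ifP.
Qed.

Lemma hausdorff1_setI1 (R : realType) d (A : set 'rV[R]_d) y :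
  hausdorff1 (A `&` [set y]) = 0%E.
Proof.
apply/eqP; rewrite eq_le hausdorff1_ge0 andbT.
apply: ge_ereal_sup => _ [delta delta0 <-].
have y0 : (diameter [set y] <= 0)%E.
  by apply: diameter_le => // _ _ -> ->; rewrite eucl_distxx.
apply: ereal_inf_lbound; exists (fun=> [set y]).
  split; first by move=> x [_ xy]; exists 0%N.
  by move=> _; apply: le_trans y0 _; rewrite lee_fin ltW.
by apply: eseries0 => n _ _; apply/eqP; rewrite eq_le diameter_ge0 y0.
Qed.

Lemma open_borel (R : realType) d (U : set (borel R d)) :
  @open 'rV[R]_d U -> measurable U.
Proof. by move=> oU; exact: sub_sigma_algebra. Qed.

Lemma closed_borel (R : realType) d (F : set (borel R d)) :
  @closed 'rV[R]_d F -> measurable F.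
Proof.
move=> cF; rewrite -(setCK F); apply: measurableC.
by apply: open_borel; exact: closed_openC.
Qed.

(** * Connected sets have length *)

(** The distance to [x] takes every value of the interval ]0, r[ on [C], at
    points that lie in the ball. *)
Lemma hausdorff1_connected_eball (R : realType) d (C : set 'rV[R]_d) x z (r : R) :
  connected C -> closure C x -> C z -> r <= eucl_dist x z ->
  (r%:E <= hausdorff1 (C `&` eball x r))%E.
Proof.
move=> cC Cx Cz rxz.
apply: (@hausdorff1_lipschitz _ _ _ (eucl_dist x)); first exact: eucl_dist_lip.
move=> t /=; rewrite in_itv/= => /andP[t0 tr].
have itvC : is_interval (eucl_dist x @` C).
  apply/connected_intervalP/connected_continuous_connected => //.
  exact/continuous_subspaceT/continuous_eucl_dist.
have [y Cy yt] := (closure_eball C x).1 Cx t t0.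
have [u Cu ut] : (eucl_dist x @` C) t.
  apply: (itvC (eucl_dist x y) (eucl_dist x z)); [by exists y|by exists z|].
  by rewrite (ltW yt) (ltW (lt_le_trans tr rxz)).
by exists u => //; split => //; rewrite /eball/= ut.
Qed.

Lemma eucl_dist_le_hausdorff1 (R : realType) d (C : set 'rV[R]_d) x z :
  connected C -> closure C x -> C z ->
  ((eucl_dist x z)%:E <= hausdorff1 C)%E.
Proof.
move=> cC Cx Cz.
apply: le_trans (hausdorff1_connected_eball cC Cx Cz (lexx _)) _.
by apply: hausdorff1_le => y [].
Qed.

(** * Sets at which a disjoint set has positive density are null *)

Definition eballs (R : realType) d (C : set 'rV[R]_d) (r : R)
    (s : seq 'rV[R]_d) : set (borel R d) :=
  [set y | C y /\ exists2 x, x \in s & eucl_dist x y < r].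

Section packing.
Context (R : realType) (d : nat) (mu : probability (borel R d) R).
Variables (C : set (borel R d)) (a : R).
Hypotheses (mC : measurable C) (a0 : 0 <= a).

Let eballs_cons r x s : eballs C r (x :: s) = (C `&` eball x r) `|` eballs C r s.
Proof.
apply/seteqP; split=> [y [Cy [z]]|y [[Cy xy]|[Cy [z zs zy]]]].
- rewrite inE => /orP[/eqP->|zs] zy; [by left|by right; split => //; exists z].
- by split => //; exists x => //; rewrite mem_head.
- by split => //; exists z => //; rewrite inE zs orbT.
Qed.

Lemma measurable_eballs r s : measurable (eballs C r s).
Proof.
elim: s => [|x s IH].
  by rewrite (_ : eballs _ _ _ = set0)//; apply/seteqP; split => // y [_ []].
rewrite eballs_cons; apply: measurableU => //; apply: measurableI => //.
by apply: open_borel; exact: open_eball.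
Qed.

(** The balls of radius r / 2 centred at r-separated points are disjoint. *)
Lemma packing_bound (r : R) (s : seq 'rV[R]_d) :
  (forall x, x \in s -> ((r / 2)%:E <= a%:E * mu (C `&` eball x (r / 2)))%E) ->
  pairwise (fun x y => r <= eucl_dist x y) s ->
  (((size s)%:R * (r / 2))%:E <= a%:E * mu (eballs C (r / 2) s))%E.
Proof.
elim: s => [_ _|x s IH rs /= /andP[/allP xs prs]].
  by rewrite mul0r mule_ge0.
rewrite eballs_cons measureU//; [|by apply: measurableI => //;
  apply: open_borel; exact: open_eball|exact: measurable_eballs|]; last first.
- apply/seteqP; split => // y [[_ xy] [_ [z zs zy]]].
  have := xs _ zs; rewrite leNgt => /negP; apply.
  apply: le_lt_trans (eucl_distD y _ _) _.
  by rewrite [ltRHS](splitr r) ltrD// eucl_distC.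
rewrite ge0_muleDr// -natr1 mulrDl mul1r addrC EFinD leeD//.
  by apply: rs; rewrite mem_head.
by apply: IH => // y ys; apply: rs; rewrite inE ys orbT.
Qed.

(** The packing bound limits the number of points of an r-separated set, so
    there is one of maximal cardinality; by maximality it is an r-net of [Q]. *)
Lemma ex_maximal_packing (Q : set 'rV[R]_d) (r : R) : 0 < r ->
  (forall x, Q x -> ((r / 2)%:E <= a%:E * mu (C `&` eball x (r / 2)))%E) ->
  exists s : seq 'rV[R]_d,
    [/\ forall x, x \in s -> Q x, pairwise (fun x y => r <= eucl_dist x y) s &
        forall x, Q x -> exists2 y, y \in s & eucl_dist y x < r].
Proof.
move=> r0 Qr.
pose P N := `[< exists s : seq 'rV[R]_d, [/\ size s = N,
  forall x, x \in s -> Q x & pairwise (fun x y => r <= eucl_dist x y) s] >].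
have P0 : exists N, P N by exists 0%N; apply/asboolP; exists [::].
have Pub N : P N -> (N <= Num.bound (a / (r / 2)))%N.
  move=> /asboolP[s [<- sQ prs]].
  have := packing_bound (fun x xs => Qr x (sQ x xs)) prs.
  move=> h.
  have : (((size s)%:R * (r / 2))%:E <= a%:E)%E.
    apply: le_trans h _; rewrite -[leRHS]mule1 lee_pmul//.
    by apply: probability_le1; exact: measurable_eballs.
  rewrite lee_fin -ler_pdivlMr; last by rewrite divr_gt0.
  move=> sa; rewrite -(ler_nat R); apply: le_trans sa _; apply: ltW.
  by apply: archi_boundP; rewrite divr_ge0// divr_ge0// ltW.
case: (ex_maxnP P0 Pub) => N /asboolP[s [sN sQ prs]] Nmax.
exists s; split => // x Qx.
apply: contrapT => far.
have : P N.+1.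
  apply/asboolP; exists (x :: s); split; first by rewrite /= sN.
    by move=> y; rewrite inE => /orP[/eqP->//|/sQ].
  rewrite /= prs andbT; apply/allP => y ys; rewrite leNgt; apply/negP => xy.
  by apply: far; exists y => //; rewrite eucl_distC.
by move=> /Nmax; rewrite ltnn.
Qed.

End packing.

Section null.
Context (R : realType) (d : nat) (mu : probability (borel R d) R).
Variables (C : set (borel R d)) (a : R).
Hypotheses (mC : measurable C) (a0 : 0 <= a).

(** The mass of [C] in the neighbourhood of [Q] of radius 1 / (j + 1) tends to 0,
    because these neighbourhoods decrease to [Q], which is disjoint from [C].  As
    this mass controls the number of points of an r-net of [Q] times r, the balls
    of radius r around the net have arbitrarily small total diameter. *)
Lemma hausdorff1_null (Q : set 'rV[R]_d) (r0 : R) : 0 < r0 -> closed Q ->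
  Q `&` C = set0 ->
  (forall x r, Q x -> 0 < r -> r <= r0 ->
     (r%:E <= a%:E * mu (C `&` eball x r))%E) ->
  hausdorff1 Q = 0%E.
Proof.
move=> r00 cQ QC Qr.
pose V (j : nat) : set (borel R d) :=
  C `&` [set y | exists2 q, Q q & eucl_dist q y < j.+1%:R^-1].
have oV j : @open 'rV[R]_d [set y | exists2 q, Q q & eucl_dist q y < j.+1%:R^-1].
  rewrite (_ : [set _ | _] = \bigcup_(q in Q) eball q j.+1%:R^-1).
    by apply: bigcup_open => q _; exact: open_eball.
  by apply/seteqP; split=> y [q Qq qy]; exists q.
have mV j : measurable (V j) by apply: measurableI => //; exact: open_borel.
have capV : \bigcap_j V j = set0.
  apply/seteqP; split => // y Vy; have [Cy _] := Vy 0%N I.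
  suff Qy : Q y by rewrite -[set0]QC.
  rewrite (closure_id Q).1//; apply/closure_eball => r r_gt0.
  pose j := Num.bound r^-1.
  have [_ [q Qq qy]] := Vy j I; exists q => //; rewrite eucl_distC.
  exact: lt_trans qy (invr_boundS_lt r_gt0).
have niV : nonincreasing_seq V.
  apply/nonincreasing_seqP => j; apply/subsetPset => y [Cy [q Qq qy]].
  split => //; exists q => //; apply: lt_le_trans qy _.
  by rewrite lef_pV2 ?posrE// ler_nat.
have muV : mu \o V @ \oo --> 0%E.
  rewrite -(measure0 mu) -capV; apply: nonincreasing_cvg_mu => //.
  - by apply: le_lt_trans (probability_le1 _ _) (ltry _).
  - by rewrite capV.
apply/eqP; rewrite eq_le hausdorff1_ge0 andbT.
apply: ge_ereal_sup => _ [delta /= delta0 <-].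
apply/lee_addgt0Pr => e e0; rewrite add0e.
have [j aVj] : exists j, (a%:E * mu (V j) <= (e / 4)%:E)%E.
  have : (fun j => a%:E * mu (V j))%E @ \oo --> (a%:E * 0)%E.
    exact: cvgeZl.
  rewrite mule0 => /fine_cvgP[_].
  have e40 : 0 < e / 4 by rewrite divr_gt0.
  move=> /cvgrPdist_lt /(_ _ e40)[j _ /(_ j (leqnn j))]/=.
  rewrite sub0r normrN => h; exists j.
  have fV : (mu (V j) \is a fin_num)%E by exact: fin_num_measure.
  rewrite -(fineK fV) -EFinM lee_fin; apply: le_trans (ltW h).
  by rewrite -(fineK fV) -EFinM/= ler_norm.
pose r := Num.min (Num.min r0 j.+1%:R^-1) (delta / 2).
have r_gt0 : 0 < r by rewrite !lt_min r00 invr_gt0 ltr0n divr_gt0.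
have rr0 : r <= r0 by rewrite !ge_min lexx.
have rj : r <= j.+1%:R^-1 by rewrite !ge_min lexx orbT.
have rd : r * 2 <= delta by rewrite -ler_pdivlMr// !ge_min lexx !orbT.
have r2r : r / 2 <= r by rewrite ler_pdivrMr// ler_peMr ?(ltW r_gt0)// ler1n.
have Qr2 x : Q x -> ((r / 2)%:E <= a%:E * mu (C `&` eball x (r / 2)))%E.
  by move=> Qx; apply: Qr => //; [rewrite divr_gt0|exact: le_trans rr0].
have [s [sQ prs sr]] := ex_maximal_packing mC a0 r_gt0 Qr2.
have bound := packing_bound mC a0 (fun x xs => Qr2 x (sQ x xs)) prs.
have sbound : (size s)%:R * (r / 2) <= e / 4.
  rewrite -lee_fin; apply: le_trans bound (le_trans _ aVj).
  apply: lee_wpmul2l; first by rewrite lee_fin.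
  apply: le_measure; rewrite ?inE//.
    exact: measurable_eballs.
  move=> y [Cy [x xs xy]]; split => //; exists x; first exact: sQ.
  exact: lt_le_trans xy (le_trans r2r rj).
pose U n : set 'rV[R]_d := if (n < size s)%N then eball (nth 0 s n) r else set0.
have dU n : (diameter (U n) <= (if (n < size s)%N then r * 2 else 0)%:E)%E.
  rewrite /U; case: ifP => _; last by rewrite diameter0.
  apply: diameter_le => [|x y xr yr]; first by rewrite mulr_ge0// ltW.
  apply: le_trans (eucl_distD (nth 0 s n) _ _) _.
  by rewrite mulr2n mulrDr mulr1 lerD ?ltW// eucl_distC.
apply: (@le_trans _ _ (\sum_(0 <= n <oo) diameter (U n))%E).
  apply: ereal_inf_lbound; exists U => //; split=> [x /sr[y ys yx]|n].
    by exists (index y s) => //; rewrite /U index_mem ys nth_index.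
  apply: le_trans (dU n) _; rewrite lee_fin; case: ifP => // _.
  exact: ltW.
apply: lime_le.
  by apply: is_cvg_nneseries => n _ _; exact: diameter_ge0.
exists (size s) => // n /= sn.
apply: (@le_trans _ _ (\sum_(0 <= k < size s) diameter (U k))%E).
  rewrite (@big_cat_nat _ _ _ (size s))//= [X in (_ + X)%E]big_nat_cond.
  rewrite [X in (_ + X)%E]big1 ?adde0// => k /andP[/andP[sk _] _].
  by rewrite /U ltnNge sk diameter0.
apply: (@le_trans _ _ (\sum_(0 <= k < size s) (r * 2)%:E)%E).
  rewrite big_nat_cond [leRHS]big_nat_cond.
  apply: lee_sum => k /andP[/andP[_ ks] _].
  by apply: le_trans (dU k) _; rewrite ks.
rewrite sumEFin lee_fin sumr_const_nat subn0 -mulr_natl.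
move: sbound; rewrite ler_pdivlMr//; apply: le_trans.
by rewrite le_eqVlt; apply/orP; left; apply/eqP; field.
Qed.

End null.

(** * Cutting connected sets *)

(** If [C `|` V] split into two separated parts, the part that misses [C] would lie
    in [V], hence be separated from [U] too, and would disconnect [S]. *)
Lemma connected_setU_separated (T : topologicalType) (S C U V : set T) :
  connected S -> connected C -> C `<=` S -> S `\` C = U `|` V ->
  separated U V -> connected (C `|` V).
Proof.
move=> cS cC CS SC [UV1 UV2]; apply/connectedP => E [E0 CVE sE].
have [b CEb] : exists b, C `<=` E b.
  have [] := connected_subset sE _ cC; first by rewrite -CVE; left.
  - by exists false.
  - by exists true.
have {sE}sE : separated (E b) (E (~~ b)).
  by case: b CEb => // _; rewrite separatedC.
have {CVE}CVE : C `|` V = E b `|` E (~~ b).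
  by rewrite CVE; case: b CEb sE => // _ _; rewrite setUC.
have EV : E (~~ b) `<=` V.
  move=> x Ex; have : (C `|` V) x by rewrite CVE; right.
  case=> // /CEb Ebx; have := separated_disjoint sE.
  by move/seteqP => -[/(_ x)]; case.
have US : U `<=` S by move=> x Ux; have : (S `\` C) x by [rewrite SC; left]; case.
have VS : V `<=` S by move=> x Vx; have : (S `\` C) x by [rewrite SC; right]; case.
move: cS => /connectedP /(_ (fun c => if c then E (~~ b) else E b `|` U)); apply.
split.
- case=> //; have [x Ex] := E0 b; by exists x; left.
- rewrite setUAC -CVE -(setUC U) setUA (setUC U) -setUA -SC.
  by rewrite setUDr setDv setD0; apply/esym/setUidr.
- case: sE => sE1 sE2; split.
  + rewrite closureU setIUl sE1 set0U; apply/seteqP; split => // x [Ux Ex].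
    by rewrite -UV1; split => //; exact: EV.
  + rewrite setIUl sE2 set0U; apply/seteqP; split => // x [Ux Ex].
    by rewrite -UV2; split => //; exact: closureS Ex.
Qed.

(** If the complement of the component [C] split into two separated parts, the part
    that misses [D] could be added to [C] by [connected_setU_separated], against
    the maximality of [C]. *)
Lemma connected_setD_component (T : topologicalType) (S D : set T) (x : T) :
  connected S -> connected D -> D `<=` S ->
  connected (S `\` connected_component (S `\` D) x).
Proof.
move=> cS cD DS; set C := connected_component _ x.
have [SDx|SDx] := pselect ((S `\` D) x); last first.
  by rewrite /C connected_component_out// setD0.
have CSD : C `<=` S `\` D by exact: connected_component_sub.
have Cx : C x by exact: connected_component_refl.
have cC : connected C by exact: component_connected.
have DSC : D `<=` S `\` C by move=> y Dy; split; [exact: DS|move=> /CSD[]].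
apply/connectedP => E [E0 SCE sE].
have [b DEb] : exists b, D `<=` E b.
  have [] := connected_subset sE _ cD; first by rewrite -SCE.
  - by exists false.
  - by exists true.
have {sE}sE : separated (E b) (E (~~ b)).
  by case: b DEb => // _; rewrite separatedC.
have {SCE}SCE : S `\` C = E b `|` E (~~ b).
  by rewrite SCE; case: b DEb sE => // _ _; rewrite setUC.
have cCE : connected (C `|` E (~~ b)).
  by apply: connected_setU_separated SCE sE => // y /CSD[].
have ESC : E (~~ b) `<=` S `\` C by rewrite SCE; right.
have CEC : C `|` E (~~ b) `<=` C.
  apply: connected_component_max => //; first by left.
  move=> y [/CSD//|Ey]; split; first by have [] := ESC _ Ey.
  move=> /DEb Eby; have := separated_disjoint sE.
  by move/seteqP => -[/(_ y)]; case.
have [y Ey] := E0 (~~ b).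
by have [_] := ESC _ Ey; apply; apply: CEC; right.
Qed.

(** * Supports of measures *)

Lemma closed_supp (R : realType) d (mu : probability (borel R d) R) :
  closed (supp mu).
Proof.
move=> x clx U oU Ux; have [y [/(_ U oU) + Uy]] := clx U (open_nbhs_nbhs (conj oU Ux)).
exact.
Qed.

Lemma supp_sub_closed (R : realType) d (mu : probability (borel R d) R)
    (F : set 'rV[R]_d) : closed F -> mu (~` F) = 0%E -> supp mu `<=` F.
Proof.
move=> cF muF x; apply: contraPP => nFx /(_ _ (closed_openC cF) nFx).
by rewrite muF ltxx.
Qed.

(** A point outside the support lies in a null ball with rational centre and radius
    1 / (k + 1), and these balls are countably many. *)
Lemma supp_conull (R : realType) d (mu : probability (borel R d) R) :
  mu (~` supp mu) = 0%E.
Proof.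
pose B (i : 'rV[rat]_d * nat) : set 'rV[R]_d :=
  ball (map_mx (@ratr R) i.1) i.2.+1%:R^-1.
pose F n : set (borel R d) :=
  if unpickle n is Some i then if mu (B i) == 0%E then B i else set0 else set0.
have mB i : measurable (B i : set (borel R d)).
  by apply: open_borel; apply: ball_open; rewrite invr_gt0.
have mF n : measurable (F n).
  by rewrite /F; case: unpickle => // i; case: ifP.
have F0 n : mu (F n) = 0%E.
  by rewrite /F; case: unpickle => [i|//]; case: ifP => // /eqP.
have ms : measurable (~` supp mu : set (borel R d)).
  by apply: open_borel; apply: closed_openC; exact: closed_supp.
have sub : (~` supp mu : set (borel R d)) `<=` \bigcup_n F n.
  move=> x /existsNP[U] /not_implyP[oU] /not_implyP[Ux] /negP.
  rewrite -leNgt => muU.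
  have /nbhs_ballP[r /= r0 rU] : nbhs x U by apply: open_nbhs_nbhs.
  pose k := Num.bound (r / 2)^-1.
  have kr : k.+1%:R^-1 < r / 2 by apply: invr_boundS_lt; rewrite divr_gt0.
  have k0 : 0 < k.+1%:R^-1 :> R by rewrite invr_gt0.
  have ex_rat i : exists q : rat, `|ratr q - x ord0 i| < k.+1%:R^-1.
    have : x ord0 i - k.+1%:R^-1 < x ord0 i + k.+1%:R^-1.
      by rewrite ltrD2l gtrN.
    move=> /rat_in_itvoo[q]; rewrite in_itv/= => /andP[q1 q2]; exists q.
    by rewrite ltr_distl q1 q2.
  have [q qP] := choice ex_rat.
  pose c : 'rV[rat]_d := \row_i q i.
  have xc : B (c, k) x.
    split=> [|i j]; first by rewrite invr_gt0.
    by rewrite ord1 !mxE /ball/=; exact: qP.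
  have BU : B (c, k) `<=` U.
    move=> y yc; apply: rU.
    have : ball x (k.+1%:R^-1 + k.+1%:R^-1) y by apply: ball_triangle yc; exact: ball_sym.
    by apply: le_ball; rewrite [leRHS](splitr r) lerD// ltW.
  exists (pickle (c, k)) => //; rewrite /F pickleK.
  case: ifPn => // /negP; case; apply/eqP/eqP; rewrite eq_le measure_ge0 andbT.
  by apply: le_trans muU; apply: le_measure; rewrite ?inE//; exact: open_borel.
apply/(negligibleP mu ms).
apply: (@negligibleS _ (borel R d) _ mu _ _ sub); apply: negligible_bigcup => n.
by apply/negligibleP => //; exact: F0.
Qed.

(** A nondegenerate connected set has positive length in every ball centred at one
    of its points, thus the length bound forces [mu] to charge these balls. *)
Lemma supp_eq (R : realType) d (mu : probability (borel R d) R)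
    (S : set 'rV[R]_d) (a : R) x0 x1 :
  closed S -> connected S -> S x0 -> S x1 -> x0 <> x1 -> mu (~` S) = 0%E ->
  (forall B : set (borel R d), measurable B ->
    hausdorff1 (S `&` B) <= a%:E * mu B)%E ->
  supp mu = S.
Proof.
move=> cS coS S0 S1 x01 muS HS; apply/seteqP; split.
  exact: supp_sub_closed.
move=> x Sx U oU Ux; have [r r0 rU] := open_sub_eball oU Ux.
have [z Sz xz] : exists2 z, S z & 0 < eucl_dist x z.
  have [<-|x0x] := pselect (x0 = x).
    by exists x1 => //; exact: eucl_dist_gt0.
  by exists x0 => //; apply: eucl_dist_gt0 => /esym.
pose s := Num.min r (eucl_dist x z).
have s0 : 0 < s by rewrite lt_min r0.
have mball : measurable (eball x s : set (borel R d)).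
  by apply: open_borel; exact: open_eball.
have : (0 < a%:E * mu (eball x s))%E.
  apply: lt_le_trans (HS _ mball); apply: (@lt_le_trans _ _ s%:E) => //.
  apply: hausdorff1_connected_eball Sz _ => //; first exact: subset_closure.
  by rewrite ge_min lexx orbT.
have [->|mu0 _] := eqVneq (mu (eball x s)) 0%E; first by rewrite mule0 ltxx.
apply: (@lt_le_trans _ _ (mu (eball x s))); first by rewrite lt0e mu0/=.
apply: le_measure; rewrite ?inE//; first exact: open_borel.
apply: subset_trans rU => y; rewrite /eball/= => xy.
by apply: lt_le_trans xy _; rewrite ge_min lexx.
Qed.

(** * Arcs of a loop and the branches they carry *)

Lemma connected_sub_closure (T : topologicalType) (C B : set T) :
  connected C -> C `<=` B -> B `<=` closure C -> connected B.
Proof.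
move=> cC CB BC; apply/connectedP => E [E0 BE sE].
have [b CEb] : exists b, C `<=` E b.
  have [] := connected_subset sE _ cC; first by rewrite -BE.
  - by exists false.
  - by exists true.
have {sE}[sE _] : separated (E b) (E (~~ b)).
  by case: b CEb => // _; rewrite separatedC.
have EB : E (~~ b) `<=` B by rewrite BE; case: b {CEb sE}; [left|right].
have [x Ex] := E0 (~~ b).
suff : (@set0 T) x by [].
by rewrite -sE; split => //; exact/(closureS CEb)/BC/EB.
Qed.

(** A component of [S `\` D] is relatively closed in it. *)
Lemma measurable_component (R : realType) d (S D : set (borel R d)) x0 :
  @closed 'rV[R]_d S -> measurable D ->
  measurable (connected_component (S `\` D : set 'rV[R]_d) x0 : set (borel R d)).
Proof.
move=> cS mD; have [Sx0|Sx0] := pselect ((S `\` D) x0); last first.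
  by rewrite connected_component_out.
set C := connected_component _ _.
rewrite (_ : C = closure C `&` (S `\` D)).
  apply: measurableI; first by apply: closed_borel; exact: closed_closure.
  by apply: measurableD => //; exact: closed_borel.
apply/seteqP; split => [y Cy|].
  split; first exact: subset_closure.
  exact: connected_component_sub Cy.
have CC : C `<=` closure C `&` (S `\` D).
  move=> y Cy; split; first exact: subset_closure.
  exact: connected_component_sub Cy.
apply: connected_component_max.
- by apply: CC; exact: connected_component_refl.
- by move=> y [].
- by apply: connected_sub_closure CC _; [exact: component_connected|move=> y []].
Qed.

(** The complement in [S] of the first component is connected, meets the second
    component through [D1] and avoids [D2], which lies in the first component; it
    is therefore contained in the second component. *)
Lemma setD_component_disjoint (T : topologicalType) (S D1 D2 : set T) (x0 : T) :
  connected S -> connected D1 -> D1 `<=` S -> D1 !=set0 ->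
  D1 `<=` connected_component (S `\` D2) x0 ->
  D2 `<=` connected_component (S `\` D1) x0 ->
  (S `\` connected_component (S `\` D1) x0) `&`
  (S `\` connected_component (S `\` D2) x0) = set0.
Proof.
move=> cS cD1 D1S [y0 Dy0] D12 D21.
set C1 := connected_component (S `\` D1) x0.
set C2 := connected_component (S `\` D2) x0.
have D1C y : D1 y -> ~ C1 y by move=> Dy /connected_component_sub[].
have SDx0 : (S `\` D2) x0.
  apply: contrapT => /connected_component_out C20.
  by have := D12 _ Dy0; rewrite C20.
have GC : S `\` C1 `<=` C2.
  apply: (@subset_trans _ (C2 `|` (S `\` C1))); first by move=> y; right.
  apply: connected_component_max.
  - by left; exact: connected_component_refl.
  - move=> y [/connected_component_sub//|[Sy C1y]]; split => //.
    by move=> /D21.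
  - apply: connectedU; last exact: connected_setD_component.
      by exists y0; split; [exact: D12|split; [exact: D1S|exact: D1C]].
    exact: component_connected.
by apply/seteqP; split => // y [/GC C2y []].
Qed.

(** Two arcs [phi] and [psi], parametrised by [-1, 1], share their endpoints and form
    a loop in [S].  Using two arcs rather than one periodic parametrisation makes
    [phi] injective on a segment, and the loop is covered by exchanging the
    roles of [phi] and [psi]. *)
Section half_loop.
Context (R : realType) (d : nat).
Variables (S : set 'rV[R]_d) (phi psi : R -> 'rV[R]_d).
Hypotheses (cS : connected S).
Hypotheses (phi_cont : {within `[-1, 1], continuous phi}).
Hypotheses (psi_cont : {within `[-1, 1], continuous psi}).
Hypotheses (phiS : phi @` `[-1, 1] `<=` S) (psiS : psi @` `[-1, 1] `<=` S).
Hypotheses (phi_inj : forall s t : R, s \in `[-1, 1] -> t \in `[-1, 1] ->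
  phi s = phi t -> s = t).
Hypotheses (psiN1 : psi (-1) = phi (-1)) (psi1 : psi 1 = phi 1).
Hypotheses (phi_psi : forall s t : R, s \in `]-1, 1[ -> t \in `[-1, 1] ->
  phi s <> psi t).

Definition arc s t : set 'rV[R]_d := phi @` `]s, t[.

(** What remains connected to the loop when the open arc is removed from [S]; the
    complement consists of the arc and of the branches hanging on it. *)
Definition arc_rest s t : set 'rV[R]_d :=
  connected_component (S `\` arc s t) (phi (-1)).

Lemma connected_arc s t : -1 <= s -> t <= 1 -> connected (arc s t).
Proof.
move=> s1 t1; apply: connected_continuous_connected.
  apply/connected_intervalP; exact: interval_is_interval.
apply: continuous_subspaceW phi_cont => u /=; rewrite !in_itv/= => /andP[su ut].
by rewrite (le_trans s1 (ltW su)) (le_trans (ltW ut) t1).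
Qed.

Lemma connected_phi_itv s t : -1 <= s -> t <= 1 -> connected (phi @` `[s, t]).
Proof.
move=> s1 t1; apply: connected_continuous_connected.
  apply/connected_intervalP; exact: interval_is_interval.
apply: continuous_subspaceW phi_cont => u /=; rewrite !in_itv/= => /andP[su ut].
by rewrite (le_trans s1 su) (le_trans ut t1).
Qed.

Lemma compact_phi_itv s t : -1 <= s -> t <= 1 -> compact (phi @` `[s, t]).
Proof.
move=> s1 t1; apply: continuous_compact; last exact: segment_compact.
apply: continuous_subspaceW phi_cont => u /=; rewrite !in_itv/= => /andP[su ut].
by rewrite (le_trans s1 su) (le_trans ut t1).
Qed.

Lemma closed_phi_itv s t : -1 <= s -> t <= 1 -> closed (phi @` `[s, t]).
Proof.
move=> s1 t1; apply: compact_closed; first exact: norm_hausdorff.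
exact: compact_phi_itv.
Qed.

Lemma arc_sub s t : -1 <= s -> t <= 1 -> arc s t `<=` S.
Proof.
move=> s1 t1 y [u /=]; rewrite in_itv/= => /andP[su ut] <-; apply: phiS.
by exists u => //=; rewrite in_itv/= (le_trans s1 (ltW su)) (le_trans (ltW ut) t1).
Qed.

(** By injectivity the open arc is a difference of compact arcs. *)
Lemma measurable_arc s t : -1 <= s -> s < t -> t <= 1 ->
  measurable (arc s t : set (borel R d)).
Proof.
move=> s1 st t1.
rewrite (_ : arc s t = phi @` `[-1, 1] `\` (phi @` `[-1, s] `|` phi @` `[t, 1])).
  apply: measurableD; first by apply: closed_borel; exact: closed_phi_itv.
  apply: measurableU; apply: closed_borel; apply: closed_phi_itv => //.
    exact: le_trans (ltW st) t1.
  exact: le_trans s1 (ltW st).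
apply/seteqP; split=> [y [u /=]|y [[u /=]]]; rewrite !in_itv/=.
  move=> /andP[su ut] <-.
  have u11 : u \in `[-1, 1].
    by rewrite in_itv/= (le_trans s1 (ltW su)) (le_trans (ltW ut) t1).
  split; first by exists u.
  move=> [|] [v /=]; rewrite in_itv/= => /andP[v1 v2] vu.
    have v11 : v \in `[-1, 1].
      by rewrite in_itv/= v1 (le_trans v2 (le_trans (ltW st) t1)).
    by move: su; rewrite -(phi_inj v11 u11 vu) ltNge v2.
  have v11 : v \in `[-1, 1].
    by rewrite in_itv/= v2 (le_trans s1 (le_trans (ltW st) v1)).
  by move: ut; rewrite -(phi_inj v11 u11 vu) ltNge v1.
move=> /andP[u1 u2] <- /not_orP[us ut]; exists u => //=; rewrite in_itv/=.
apply/andP; split; rewrite ltNge; apply/negP => h.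
  by apply: us; exists u => //=; rewrite in_itv/= u1.
by apply: ut; exists u => //=; rewrite in_itv/= h.
Qed.

(** The rest of the loop is connected: it is made of three arcs that meet at the
    common endpoints of [phi] and [psi]. *)
Lemma arc_rest_sup s t : -1 <= s -> s < t -> t <= 1 ->
  phi @` `[-1, s] `|` psi @` `[-1, 1] `|` phi @` `[t, 1] `<=` arc_rest s t.
Proof.
move=> s1 st t1.
have N11 : -1 <= 1 :> R by rewrite (le_trans s1)// (le_trans (ltW st)).
have sle1 : s <= 1 := le_trans (ltW st) t1.
have tge1 : -1 <= t := le_trans s1 (ltW st).
have itvP : phi @` `[-1, s] `|` psi @` `[-1, 1] `|` phi @` `[t, 1] `<=`
    S `\` arc s t.
  move=> y [[|]|] [u /=]; rewrite in_itv/= => /andP[u1 u2] <-.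
  - have u11 : u \in `[-1, 1] by rewrite in_itv/= u1 (le_trans u2).
    split; first by apply: phiS; exists u.
    move=> [v /=]; rewrite in_itv/= => /andP[sv vt] vu.
    have v11 : v \in `[-1, 1].
      by rewrite in_itv/= (le_trans s1 (ltW sv)) (le_trans (ltW vt) t1).
    by move: sv; rewrite (phi_inj v11 u11 vu) ltNge u2.
  - have u11 : u \in `[-1, 1] by rewrite in_itv/= u1.
    split; first by apply: psiS; exists u.
    move=> [v /=]; rewrite in_itv/= => /andP[sv vt].
    apply: phi_psi => //.
    by rewrite in_itv/= (le_lt_trans s1 sv) (lt_le_trans vt t1).
  - have u11 : u \in `[-1, 1] by rewrite in_itv/= u2 (le_trans tge1).
    split; first by apply: phiS; exists u.
    move=> [v /=]; rewrite in_itv/= => /andP[sv vt] vu.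
    have v11 : v \in `[-1, 1].
      by rewrite in_itv/= (le_trans s1 (ltW sv)) (le_trans (ltW vt) t1).
    by move: vt; rewrite (phi_inj v11 u11 vu) ltNge u1.
apply: connected_component_max => //.
- by left; left; exists (-1) => //=; rewrite in_itv/= lexx s1.
- apply: connectedU.
  + exists (phi 1); split; last by exists 1 => //=; rewrite in_itv/= lexx t1.
    by right; exists 1 => //=; rewrite in_itv/= lexx N11.
  + apply: connectedU.
    * exists (phi (-1)); split; first by exists (-1) => //=; rewrite in_itv/= lexx s1.
      by exists (-1) => //=; rewrite in_itv/= lexx N11.
    * exact: connected_phi_itv.
    * apply: connected_continuous_connected => //.
      apply/connected_intervalP; exact: interval_is_interval.
  + exact: connected_phi_itv.
Qed.

Lemma phi_closure_arc s t : -1 <= s -> s < t -> t <= 1 -> closure (arc s t) (phi s).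
Proof.
move=> s1 st t1.
have cst : {within `[s, t], continuous phi}.
  apply: continuous_subspaceW phi_cont => u /=; rewrite !in_itv/= => /andP[su ut].
  by rewrite (le_trans s1 su) (le_trans ut t1).
have [_ cvgs _] := (continuous_within_itvP phi st).1 cst.
move=> U /cvgs sU.
have : \forall u \near s^'+, phi u \in U /\ u \in `]s, t[.
  near=> u; split; last by rewrite in_itv/=; apply/andP; split; near: u;
    [exact: nbhs_right_gt|exact: nbhs_right_lt].
  by rewrite inE; near: u; exact: sU.
move=> /(@filter_ex _ _ (at_right_proper_filter s)) [u [/set_mem Uu ust]].
by exists (phi u); split => //; exists u.
Unshelve. all: by end_near. Qed.

Lemma arc_rest_disjoint s t s' t' : -1 <= s -> s < t -> t <= s' -> s' < t' ->
  t' <= 1 -> (S `\` arc_rest s t) `&` (S `\` arc_rest s' t') = set0.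
Proof.
move=> s1 st ts' st' t1.
have t'1 : t <= 1 := le_trans ts' (le_trans (ltW st') t1).
have s'1 : -1 <= s' := le_trans s1 (le_trans (ltW st) ts').
apply: setD_component_disjoint => //.
- exact: connected_arc.
- exact: arc_sub.
- exists (phi ((s + t) / 2)), ((s + t) / 2) => //=.
  by rewrite in_itv/= !midf_lt.
- apply: subset_trans (arc_rest_sup s'1 st' t1) => y [u /=].
  rewrite in_itv/= => /andP[su ut] <-; left; left; exists u => //=.
  by rewrite in_itv/= (le_trans s1 (ltW su)) (le_trans (ltW ut) ts').
- apply: subset_trans (arc_rest_sup s1 st t'1) => y [u /=].
  rewrite in_itv/= => /andP[su ut] <-; right; exists u => //=.
  by rewrite in_itv/= (le_trans ts' (ltW su)) (le_trans (ltW ut) t1).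
Qed.

End half_loop.

Section half_loop_length.
Context (R : realType) (d : nat) (nu : probability (borel R d) R).
Variables (a : R) (phi psi : R -> 'rV[R]_d).
Hypotheses (nua : length_bound nu a) (cS : connected (supp nu)).
Hypotheses (phi_cont : {within `[-1, 1], continuous phi}).
Hypotheses (psi_cont : {within `[-1, 1], continuous psi}).
Hypotheses (phiS : phi @` `[-1, 1] `<=` supp nu).
Hypotheses (psiS : psi @` `[-1, 1] `<=` supp nu).
Hypotheses (phi_inj : forall s t : R, s \in `[-1, 1] -> t \in `[-1, 1] ->
  phi s = phi t -> s = t).
Hypotheses (psiN1 : psi (-1) = phi (-1)) (psi1 : psi 1 = phi 1).
Hypotheses (phi_psi : forall s t : R, s \in `]-1, 1[ -> t \in `[-1, 1] ->
  phi s <> psi t).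
Variables (s t : R).
Hypotheses (s1 : -1 <= s) (st : s < t) (t1 : t <= 1).

Let C := arc_rest (supp nu) phi s t.
Let D := arc phi s t.

Let C_sup := arc_rest_sup phi_cont psi_cont phiS psiS phi_inj psiN1 psi1 phi_psi s1 st t1.

Lemma measurable_arc_rest : measurable (C : set (borel R d)).
Proof.
apply: measurable_component; first exact: closed_supp.
exact: measurable_arc.
Qed.

Lemma arc_rest_start : C (phi s).
Proof. by apply: C_sup; left; left; exists s => //=; rewrite in_itv/= s1 lexx. Qed.

Lemma arc_rest_first : C (phi (-1)).
Proof. by apply: C_sup; left; left; exists (-1) => //=; rewrite in_itv/= s1 lexx. Qed.

Lemma arc_rest_last : C (phi 1).
Proof. by apply: C_sup; right; exists 1 => //=; rewrite in_itv/= t1 lexx. Qed.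

Lemma phi_ends : phi (-1) <> phi 1.
Proof.
have N11 : -1 < 1 :> R by rewrite (le_lt_trans s1)// (lt_le_trans st).
move=> /phi_inj; rewrite !in_itv/= !lexx (ltW N11) => /(_ isT isT) e.
by move: N11; rewrite e ltxx.
Qed.

(** The removed part is connected with [phi s] in its closure, hence its width is
    controlled by its length, and its length by its mass. *)
Lemma arc_rest_dist e : supp nu e -> ~ C e ->
  ((eucl_dist (phi s) e)%:E <= a%:E * nu (supp nu `\` C))%E.
Proof.
move=> Se Ce.
have cG : connected (supp nu `\` C).
  apply: connected_setD_component => //; first exact: connected_arc.
  exact: arc_sub.
have clG : closure (supp nu `\` C) (phi s).
  apply: (@closureS _ D); last exact: phi_closure_arc.
  move=> y Dy; split; first exact: arc_sub Dy.
  by move=> /connected_component_sub[].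
apply: le_trans (eucl_dist_le_hausdorff1 cG clG (conj Se Ce)) _.
have := nua.2 (supp nu `\` C).
rewrite setIDA setIid; apply; apply: measurableD; last exact: measurable_arc_rest.
by apply: closed_borel; exact: closed_supp.
Qed.

(** Let x be a point of the arc in the closure of [C].  The set [C] is connected,
    comes arbitrarily close to x and contains both endpoints of [phi], one of which
    is at distance at least r0 from x; so [C] has length at least r in the ball of
    radius r <= r0, although it misses the arc. *)
Lemma arc_rest_closure_null s' t' : s < s' -> t' < t ->
  hausdorff1 (closure C `&` phi @` `[s', t']) = 0%E.
Proof.
move=> ss' t't.
pose r0 := eucl_dist (phi (-1)) (phi 1) / 2.
have CS : C `<=` supp nu by move=> y /connected_component_sub[].
apply: (@hausdorff1_null _ _ nu C a measurable_arc_rest nua.1 _ r0).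
- by rewrite divr_gt0//; apply: eucl_dist_gt0; exact: phi_ends.
- apply: closedI; first exact: closed_closure.
  apply: closed_phi_itv => //; first exact: le_trans s1 (ltW ss').
  exact: le_trans (ltW t't) t1.
- apply/seteqP; split => // y [[_ [u]]]; rewrite /= in_itv/= => /andP[u1 u2] <-.
  move=> /connected_component_sub[_]; apply; exists u => //=.
  by rewrite in_itv/= (lt_le_trans ss' u1) (le_lt_trans u2 t't).
- move=> x r [Cx _] r_gt0 rr0.
  have [z Cz xz] : exists2 z, C z & r <= eucl_dist x z.
    have [h|h] := leP r (eucl_dist x (phi (-1))).
      by exists (phi (-1)) => //; exact: arc_rest_first.
    exists (phi 1); first exact: arc_rest_last.
    have := eucl_distD x (phi (-1)) (phi 1).
    move: rr0 h; rewrite /r0 (eucl_distC x (phi (-1))).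
    move: (eucl_dist (phi (-1)) x) (eucl_dist x _) (eucl_dist _ (phi 1)) => u v w.
    lra.
  have cC : connected C by exact: component_connected.
  apply: le_trans (hausdorff1_connected_eball cC Cx Cz xz) _.
  have := nua.2 (C `&` eball x r).
  rewrite setIA (setIidr CS); apply; apply: measurableI.
    exact: measurable_arc_rest.
  by apply: open_borel; exact: open_eball.
Qed.

End half_loop_length.

(** * Measurability of distances *)

Lemma continuous_borel_measurable (R : realType) d (f : 'rV[R]_d -> R) :
  continuous f -> measurable_fun [set: borel R d] (f : borel R d -> R).
Proof.
move=> /continuousP cf; apply: (measurability _ (RGenOpens.measurableE R)).
move=> _ [_ [a [b ->] <-]]; rewrite setTI.
by apply: open_borel; apply: cf; exact: interval_open.
Qed.

(** The distance is written with coordinates, because the sigma-algebra on pairs is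
    by definition the product one, whose measurable functions are not given by
    continuity. *)
Lemma measurable_eucl_dist (R : realType) d : measurable_fun setT
  (fun z : borel R d * borel R d => eucl_dist (z.1 : 'rV[R]_d) z.2).
Proof.
rewrite /eucl_dist /eucl_norm.
apply: (@measurableT_comp _ _ _ _ _ _ (@Num.sqrt R)).
  by apply: continuous_measurable_fun; exact: sqrt_continuous.
apply: measurable_sum => i; apply: measurable_funX.
rewrite [X in measurable_fun _ X](_ : _ = fun z : borel R d * borel R d =>
  (z.1 : 'rV[R]_d) ord0 i - (z.2 : 'rV[R]_d) ord0 i); last first.
  by apply/funext => z; rewrite !mxE.
have mi : measurable_fun [set: borel R d] (fun x : 'rV[R]_d => x ord0 i).
  by apply: continuous_borel_measurable => x; exact: coord_continuous.
by apply: measurable_funB; exact: (measurableT_comp mi).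
Qed.

Lemma dist_set_le (R : realType) d (x y : 'rV[R]_d) (A : set 'rV[R]_d) :
  A y -> dist_set x A <= eucl_dist x y.
Proof.
move=> Ay; apply: ge_inf; last by exists y.
by exists 0 => _ [z _ <-]; exact: eucl_dist_ge0.
Qed.

Lemma dist_set_ge (R : realType) d (x : 'rV[R]_d) (A : set 'rV[R]_d) (r : R) :
  A !=set0 -> (forall y, A y -> r <= eucl_dist x y) -> r <= dist_set x A.
Proof.
move=> [y Ay] rA; apply: lb_le_inf; first by exists (eucl_dist x y), y.
by move=> _ [z Az <-]; exact: rA.
Qed.

Lemma dist_set_ge0 (R : realType) d (x : 'rV[R]_d) (A : set 'rV[R]_d) :
  A !=set0 -> 0 <= dist_set x A.
Proof. by move=> A0; apply: dist_set_ge => // y _; exact: eucl_dist_ge0. Qed.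

Lemma continuous_dist_set (R : realType) d (A : set 'rV[R]_d) :
  A !=set0 -> continuous (fun x : 'rV[R]_d => dist_set x A).
Proof.
move=> A0 x; move=> U /nbhs_ballP[e /= e0 eU].
have lip (u v : 'rV[R]_d) : dist_set u A <= eucl_dist u v + dist_set v A.
  rewrite -lerBlDl; apply: dist_set_ge => // y Ay; rewrite lerBlDl.
  by apply: le_trans (dist_set_le _ Ay) _; exact: eucl_distD.
apply: (@filterS _ (nbhs x) _ (eball x e)); last exact: nbhs_eball.
move=> y; rewrite /eball/= => xy; apply: eU; rewrite -ball_normE/=.
rewrite ltr_norml; have := lip x y; have := lip y x; rewrite (eucl_distC y x).
by move: xy; move: (eucl_dist _ _) (dist_set _ _) (dist_set _ _) => u v w *; lra.
Qed.

Lemma ex_pushforward (R : realType) d1 d2 (T1 : measurableType d1)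
    (T2 : measurableType d2) (P : probability T1 R) (f : T1 -> T2) :
  measurable_fun setT f ->
  exists Q : probability T2 R, (forall A, Q A = P (f @^-1` A)) /\
   forall h : T2 -> \bar R, measurable_fun setT h -> (forall y, 0 <= h y)%E ->
     (\int[Q]_y h y = \int[P]_x h (f x))%E.
Proof.
move=> mf; pose X : {mfun T1 >-> T2} := HB.pack f (isMeasurableFun.Build _ _ _ _ _ mf).
exists (distribution P X); split => // h mh h0.
exact: (@ge0_integral_distribution _ _ _ _ _ P X).
Qed.

(** For delta in [0, 1], v + delta is the convex combination of v and v + 1 with
    weights 1 - delta and delta; convexity of the power gives a bound that is
    linear in delta. *)
Lemma powR_perturb (R : realType) (p M u v delta : R) : 1 <= p ->
  0 <= v -> v <= M -> 0 <= delta -> delta <= 1 -> 0 <= u -> u <= v + delta ->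
  u `^ p <= v `^ p + (M + 1) `^ p * delta.
Proof.
move=> p1 v0 vM d0 d1 u0 uvd.
have p0 : 0 <= p by rewrite (le_trans _ p1).
apply: (@le_trans _ _ ((v + delta) `^ p)).
  by apply: ge0_ler_powR; rewrite ?nnegrE// addr_ge0.
have d01 : 0 <= delta <= 1 by rewrite d0.
have := @convex_powR R p p1 (Itv01 d0 d1) (v + 1) v.
rewrite !inE/= !in_itv/= !andbT => /(_ (addr_ge0 v0 ler01) v0).
move=> h; rewrite convRE [X in X `^ _ <= _]convRE/= /unstable.onem in h; move: h.
have -> : delta * (v + 1) + (1 - delta) * v = v + delta by ring.
move=> h; apply: le_trans h _.
have vp0 : 0 <= v `^ p by exact: powR_ge0.
have vMp : (v + 1) `^ p <= (M + 1) `^ p.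
  by apply: ge0_ler_powR; rewrite ?nnegrE ?addr_ge0 ?lerD2r// (le_trans v0).
have := ler_wpM2l d0 vMp; have := mulr_ge0 d0 vp0.
move: (_ `^ p) (_ `^ p) (_ `^ p) => V X Y ? ?; lra.
Qed.

(** * Couplings, costs and selections *)

Lemma ae_coupling_fst (R : realType) d (mu nu : probability (borel R d) R)
    (gamma : probability (borel R d * borel R d)%type R) (P : borel R d -> Prop) :
  coupling mu nu gamma -> {ae mu, forall x, P x} ->
  {ae gamma, forall z : borel R d * borel R d, P z.1}.
Proof.
move=> [g1 _] [N [mN N0 PN]]; exists (N `*` setT); split.
- exact: measurableX.
- by rewrite -N0 -g1.
- by move=> z /= Pz; split => //; exact: PN.
Qed.

Lemma ae_coupling_snd (R : realType) d (mu nu : probability (borel R d) R)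
    (gamma : probability (borel R d * borel R d)%type R) (P : borel R d -> Prop) :
  coupling mu nu gamma -> {ae nu, forall x, P x} ->
  {ae gamma, forall z : borel R d * borel R d, P z.2}.
Proof.
move=> [_ g2] [N [mN N0 PN]]; exists (setT `*` N); split.
- exact: measurableX.
- by rewrite -N0 -g2.
- by move=> z /= Pz; split => //; exact: PN.
Qed.

Lemma ae_supp (R : realType) d (mu : probability (borel R d) R) :
  {ae mu, forall x, supp mu x}.
Proof.
exists (~` supp mu); split => //; last exact: supp_conull.
by apply: open_borel; apply: closed_openC; exact: closed_supp.
Qed.

Lemma supp_nonempty (R : realType) d (mu : probability (borel R d) R) :
  supp mu !=set0.
Proof.
apply/set0P/negP => /eqP s0; have := supp_conull mu.
by rewrite s0 setC0 probability_setT => /eqP; rewrite onee_eq0.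
Qed.

Lemma supp_dist_le (R : realType) d (nu : probability (borel R d) R) (a : R) x y :
  length_bound nu a -> connected (supp nu) -> supp nu x -> supp nu y ->
  eucl_dist x y <= a.
Proof.
move=> [_ nua] cS Sx Sy; rewrite -lee_fin.
apply: le_trans (eucl_dist_le_hausdorff1 cS (subset_closure Sx) Sy) _.
by have := nua setT measurableT; rewrite setIT probability_setT mule1.
Qed.

Lemma length_functional_ge0 (R : realType) d (nu : probability (borel R d) R) :
  (0 <= length_functional nu)%E.
Proof.
rewrite /length_functional; case: ifP => // _.
by apply: le_ereal_inf_tmp => _ [a [a0 _] <-]; rewrite lee_fin.
Qed.

Lemma transport_cost_ge0 (R : realType) d (p : R)
    (gamma : probability (borel R d * borel R d)%type R) :
  (0 <= transport_cost p gamma)%E.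
Proof. by apply: integral_ge0 => z _; rewrite lee_fin powR_ge0. Qed.

Lemma wasserstein_pow_ge0 (R : realType) d (p : R)
    (mu nu : probability (borel R d) R) : (0 <= wasserstein_pow p mu nu)%E.
Proof. by apply: le_ereal_inf_tmp => _ [g _ <-]; exact: transport_cost_ge0. Qed.

Lemma wasserstein_optimal (R : realType) d (p : R)
    (mu nu : probability (borel R d) R) gamma :
  optimal_plan p mu nu gamma -> wasserstein_pow p mu nu = transport_cost p gamma.
Proof.
move=> [cg og]; apply/eqP; rewrite eq_le; apply/andP; split.
  by apply: ereal_inf_lbound; exists gamma.
by apply: le_ereal_inf_tmp => _ [g cg' <-]; exact: og.
Qed.

Lemma measurable_cost (R : realType) d (p : R) : measurable_fun setT
  (fun z : borel R d * borel R d => (eucl_dist (z.1 : 'rV[R]_d) z.2 `^ p)%:E).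
Proof.
apply/measurable_EFinP; apply: (measurableT_comp (measurable_powR p)).
exact: measurable_eucl_dist.
Qed.

(** The pairs that gain at least [eps] when they are rerouted to a closest point of
    [S]. *)
Definition excess (R : realType) d (p eps : R) (S : set 'rV[R]_d) :
    set (borel R d * borel R d) :=
  [set z | dist_set z.1 S `^ p + eps <= eucl_dist z.1 z.2 `^ p].

Lemma measurable_excess (R : realType) d (p eps : R) (S : set 'rV[R]_d) :
  S !=set0 -> measurable (excess p eps S).
Proof.
move=> S0; rewrite (_ : excess p eps S = setT `&`
  [set z : borel R d * borel R d |
   (dist_set z.1 S `^ p + eps <= eucl_dist (z.1 : 'rV[R]_d) z.2 `^ p)]); last by rewrite setTI.
apply: measurable_fun_le => //.
  apply: measurable_funD => //.
  apply: (measurableT_comp (measurable_powR p)).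
  have md : measurable_fun [set: borel R d] (fun x : 'rV[R]_d => dist_set x S).
    by apply: continuous_borel_measurable; exact: continuous_dist_set.
  exact: (measurableT_comp md).
apply: (measurableT_comp (measurable_powR p)).
exact: measurable_eucl_dist.
Qed.

Lemma ae_selection (R : realType) d (mu : probability (borel R d) R)
    (S : set 'rV[R]_d) (f : borel R d -> borel R d) (D : set (borel R d)) :
  measurable D -> mu (~` D) = 0%E ->
  {ae mu, forall x, D x -> argmin_dist S x (f x)} ->
  {ae mu, forall x, [/\ D x, S (f x) & eucl_dist x (f x) = dist_set x S]}.
Proof.
move=> mD D0; have aeD : {ae mu, forall x, D x}.
  by exists (~` D); split => //; exact: measurableC.
apply: filterS2 aeD => x Dx /(_ Dx)[Sf fmin]; split => //.
apply/eqP; rewrite eq_le dist_set_le// andbT.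
apply: dist_set_ge; first by exists (f x).
move=> y /fmin; rewrite ler_pM2l ?invr_gt0//.
by rewrite ler_pXn2r ?nnegrE ?eucl_dist_ge0.
Qed.

(** * Competitors obtained by rerouting mass *)

Lemma lee_finD (R : realType) (u v w x : R) : u + v <= w + x ->
  (u%:E + v%:E <= w%:E + x%:E)%E.
Proof. by rewrite -!EFinD lee_fin. Qed.

Section competitor.
Context (R : realType) (d : nat) (p Lambda : R).
Variables (rho0 nu : probability (borel R d) R).
Variable gamma : probability (borel R d * borel R d)%type R.
Variables (f : borel R d -> borel R d) (D : set (borel R d)) (a M : R).
Hypotheses (p1 : 1 <= p) (Lambda0 : 0 < Lambda).
Hypothesis nu_min : relaxed_minimizer p Lambda rho0 nu.
Hypothesis nu_fin : (relaxed_energy p Lambda rho0 nu < +oo)%E.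
Hypothesis gamma_opt : optimal_plan p rho0 nu gamma.
Hypotheses (mD : measurable D) (D0 : rho0 (~` D) = 0%E) (mf : measurable_fun D f).
Hypothesis f_argmin : {ae rho0, forall x, D x -> argmin_dist (supp nu) x (f x)}.
Hypotheses (nua : length_bound nu a) (cS : connected (supp nu)).
Hypothesis rho0M : {ae rho0, forall x, dist_set x (supp nu) <= M}.

Local Notation S := (supp nu).

Variables (S' : set 'rV[R]_d) (G : set (borel R d)) (q x0 x1 : 'rV[R]_d).
Hypotheses (S'closed : closed S') (S'conn : connected S') (S'S : S' `<=` S).
Hypotheses (S'0 : S' x0) (S'1 : S' x1) (x01 : x0 <> x1).
Hypotheses (mG : measurable G) (SG : S `\` G `<=` S').
Hypothesis S'G : hausdorff1 (S' `&` G) = 0%E.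
Hypothesis S'q : S' q.

Let T (x : borel R d) : borel R d :=
  if `[< (D `&` f @^-1` S') x >] then f x else q.

(** The selected closest point is used only if it survives in [S'], so that the new
    marginal lives on [S']; the fallback [q] is farther by at most [delta]. *)
Let reroute (z : borel R d * borel R d) : borel R d :=
  if `[< G z.2 >] then T z.1 else z.2.

Let mDf : measurable (D `&` f @^-1` S').
Proof. by apply: mf => //; exact: closed_borel. Qed.

Let measurable_asbool d1 (X : measurableType d1) (A : set X) : measurable A ->
  measurable_fun setT (fun x => `[< A x >]).
Proof.
move=> mA; apply: (@measurable_fun_bool _ _ _ _ true).
rewrite setTI (_ : _ @^-1` _ = A)//.
by apply/seteqP; split => x /asboolP.
Qed.

Let mT : measurable_fun setT T.
Proof.
apply: measurable_fun_if => //; first exact: measurable_asbool.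
apply: measurable_funS mf => //.
by move=> x [_ /asboolP[]].
Qed.

Let mreroute : measurable_fun setT reroute.
Proof.
apply: measurable_fun_ifT.
- by apply: (measurableT_comp (measurable_asbool mG)).
- exact: (measurableT_comp mT).
- exact: measurable_snd.
Qed.

Let TS' x : S' (T x).
Proof. by rewrite /T; case: ifP => // /asboolP[]. Qed.

Let rerouteS' z : S z.2 -> S' (reroute z).
Proof.
move=> Sz; rewrite /reroute; case: ifPn => [_|/asboolP Gz]; first exact: TS'.
exact: SG.
Qed.

Let cost (z : borel R d * borel R d) := eucl_dist (z.1 : 'rV[R]_d) z.2 `^ p.
Let cost' (z : borel R d * borel R d) :=
  eucl_dist (z.1 : 'rV[R]_d) (reroute z) `^ p.

Let cost_wasserstein :
  (\int[gamma]_z (cost z)%:E = wasserstein_pow p rho0 nu)%E.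
Proof. exact: esym (wasserstein_optimal gamma_opt). Qed.

Let cost'_in z : G z.2 -> cost' z = eucl_dist (z.1 : 'rV[R]_d) (T z.1) `^ p.
Proof. by move=> Gz; rewrite /cost' /reroute asboolT. Qed.

Let cost'_out z : ~ G z.2 -> cost' z = cost z.
Proof. by move=> Gz; rewrite /cost' /reroute asboolF. Qed.

Let mfun_graph : measurable_fun setT (fun z : borel R d * borel R d => (z.1, reroute z)).
Proof. by apply: measurable_fun_pair => //; exact: measurable_fst. Qed.

Let mcost' : measurable_fun setT (fun z => (cost' z)%:E).
Proof.
have := measurableT_comp (@measurable_cost R d p) mfun_graph; exact.
Qed.

(** The second marginal nu' of the rerouted plan has support [S'], and [b nu']
    dominates H^1 on [S'] whenever [b nu] dominates H^1 on [S], because nu' >= nu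
    outside [G] and [G] is negligible in [S'].  The length functional does not
    increase, so minimality is a statement about the transport costs. *)
Lemma rerouting_cost_ge :
  (\int[gamma]_z (cost z)%:E <= \int[gamma]_z (cost' z)%:E)%E.
Proof.
have [gamma1 gamma2] := gamma_opt.1.
have [Q [QE Qint]] := ex_pushforward gamma mfun_graph.
have [nu' [nu'E nu'int]] := ex_pushforward gamma mreroute.
have Qcoup : coupling rho0 nu' Q.
  split=> [A mA|B mB]; rewrite QE ?nu'E.
    by rewrite -gamma1.
  by congr (gamma _); apply/seteqP; split => z /=; [case|].
have nu'S' : nu' (~` S') = 0%E.
  apply/eqP; rewrite eq_le measure_ge0 andbT nu'E.
  rewrite -(supp_conull nu) -gamma2; last first.
    by apply: open_borel; apply: closed_openC; exact: closed_supp.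
  apply: le_measure; rewrite ?inE.
  - rewrite -[X in measurable X]setTI; apply: mreroute => //.
    by apply: open_borel; exact: closed_openC.
  - apply: measurableX => //; apply: open_borel.
    by apply: closed_openC; exact: closed_supp.
  - by move=> z /= S'z; split => // /rerouteS'.
have nu'_ge (B : set (borel R d)) : measurable B -> (nu (B `\` G) <= nu' B)%E.
  move=> mB; rewrite nu'E -gamma2; last exact: measurableD.
  apply: le_measure; rewrite ?inE.
  - by apply: measurableX => //; exact: measurableD.
  - by rewrite -[X in measurable X]setTI; exact: mreroute.
  - by move=> z /= [_ [Bz Gz]]; rewrite /reroute/=; case: asboolP.
have nu'_length b : length_bound nu b ->
    forall B : set (borel R d), measurable B ->
    (hausdorff1 (S' `&` B) <= b%:E * nu' B)%E.
  move=> [b0 nub] B mB; apply: (@le_trans _ _ (b%:E * nu (B `\` G))%E); last first.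
    by apply: lee_wpmul2l; [rewrite lee_fin|exact: nu'_ge].
  apply: le_trans (nub _ (measurableD mB mG)).
  apply: le_trans (hausdorff1_setU_null _ S'G).
  apply: hausdorff1_le => x [S'x Bx].
  have [Gx|Gx] := pselect (G x); first by right.
  by left; split => //; exact: S'S.
have supp_nu' : supp nu' = S'.
  exact: (supp_eq S'closed S'conn S'0 S'1 x01 nu'S' (nu'_length a nua)).
have nu'_moment : finite_moment p nu'.
  rewrite /finite_moment.
  pose N := (eucl_norm x0 + a) `^ p.
  apply: (@le_lt_trans _ _ (\int[nu']_x (cst N%:E) x)%E); last first.
    rewrite integral_cst// lte_mul_pinfty// ?lee_fin ?powR_ge0//.
    by apply: le_lt_trans (probability_le1 _ _) (ltry _).
  apply: ae_ge0_le_integral => //.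
  - by move=> x _; rewrite lee_fin powR_ge0.
  - apply/measurable_EFinP; apply: (measurableT_comp (measurable_powR p)).
    by apply: continuous_borel_measurable; exact: continuous_eucl_norm.
  - by move=> x _; rewrite lee_fin powR_ge0.
  - apply: (@filterS _ _ (ae_filter_ringOfSetsType nu') _ _ _ (ae_supp nu')).
    move=> x; rewrite supp_nu' => S'x _.
    rewrite lee_fin; apply: ge0_ler_powR.
    + by rewrite (le_trans _ p1).
    + by rewrite nnegrE eucl_norm_ge0.
    + by rewrite nnegrE addr_ge0 ?eucl_norm_ge0//; exact: nua.1.
    + have -> : x = x0 + (x - x0) by rewrite addrC subrK.
      apply: le_trans (ler_eucl_normD _ _) _; rewrite lerD2l.
      exact: supp_dist_le nua cS (S'S S'x) (S'S S'0).
have L_le : (length_functional nu' <= length_functional nu)%E.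
  rewrite /length_functional supp_nu' !asboolT//.
  apply: le_ereal_inf => _ [b nub <-]; exists b => //.
  by split; [exact: nub.1|rewrite supp_nu'; exact: nu'_length].
have W_le : (wasserstein_pow p rho0 nu' <= \int[gamma]_z (cost' z)%:E)%E.
  apply: (@le_trans _ _ (transport_cost p Q)).
    by apply: ereal_inf_lbound; exists Q.
  have c0 (z : borel R d * borel R d) : (0 <= (cost z)%:E)%E.
    by rewrite lee_fin powR_ge0.
  by have := Qint _ (@measurable_cost R d p) c0; rewrite /transport_cost => ->.
have L_fin : (Lambda%:E * length_functional nu \is a fin_num)%E.
  rewrite ge0_fin_numE.
    apply: le_lt_trans nu_fin; rewrite /relaxed_energy leeDr//.
    exact: wasserstein_pow_ge0.
  by rewrite mule_ge0 ?length_functional_ge0// lee_fin ltW.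
rewrite [leLHS]cost_wasserstein -(leeD2rE _ _ L_fin).
apply: le_trans (nu_min.2 nu' nu'_moment) _; apply: leeD => //.
by apply: lee_wpmul2l => //; rewrite lee_fin ltW.
Qed.

Variables (delta eps : R).
Hypotheses (delta0 : 0 <= delta) (delta1 : delta <= 1) (eps0 : 0 <= eps).
Hypothesis qdelta : forall e, S e -> ~ S' e -> eucl_dist q e <= delta.

(** Rerouting changes nothing outside [G]; in [G] the new cost is at most
    (dist(x, S) + delta)^p, which exceeds dist(x, S)^p by at most
    K = (M + 1)^p delta, whereas the pairs of [excess] pay at least dist(x, S)^p + eps in the
    old plan.  Integrate, and cancel the cost of the rerouted plan, which is finite. *)
Lemma excess_bound :
  (eps%:E * gamma (excess p eps S `&` (setT `*` G)) <=
   ((M + 1) `^ p * delta)%:E * nu G)%E.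
Proof.
have [gamma1 gamma2] := gamma_opt.1.
set A := _ `&` _; set K := (M + 1) `^ p * delta.
have S0 : S !=set0 by exact: supp_nonempty.
have K0 : 0 <= K by rewrite mulr_ge0// powR_ge0.
have mTG : measurable (setT `*` G : set (borel R d * borel R d)).
  exact: measurableX.
have mA : measurable A by apply: measurableI => //; exact: measurable_excess.
have Asub : A `<=` excess p eps S `&` (setT `*` G) by [].
clearbody A.
have mInd (B : set (borel R d * borel R d)) (k : R) : measurable B ->
    measurable_fun setT (fun z => (k * \1_B z)%:E).
  by move=> mB; apply/measurable_EFinP; apply: measurable_funM.
have intInd (B : set (borel R d * borel R d)) (k : R) : 0 <= k -> measurable B ->
    (\int[gamma]_z (k * \1_B z)%:E = k%:E * gamma B)%E.
  move=> k0 mB; under eq_integral do rewrite EFinM.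
  rewrite ge0_integralZl_EFin//; first by rewrite integral_indic// setIT.
  by apply/measurable_EFinP; exact: measurable_indic.
have pointwise : {ae gamma, forall z, setT z ->
    ((cost' z)%:E + (eps * \1_A z)%:E <=
     (cost z)%:E + (K * \1_(setT `*` G) z)%:E)%E}.
  have aeS := ae_coupling_snd gamma_opt.1 (ae_supp nu).
  have aef := ae_coupling_fst gamma_opt.1 (ae_selection mD D0 f_argmin).
  have aeM := ae_coupling_fst gamma_opt.1 rho0M.
  apply: filterS3 aeS aef aeM => z Sz [Dx Sfx fdist] distM _.
  apply: lee_finD.
  have d0 := dist_set_ge0 z.1 S0.
  have dxy := dist_set_le z.1 Sz.
  have [Gz|Gz] := pselect (G z.2); last first.
    rewrite cost'_out// lerD2l [X in eps * X]indicE memNset ?mulr0 ?(mulr_ge0 K0)//.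
    by move=> /Asub[_ []].
  have Tle : cost' z <= dist_set z.1 S `^ p + K.
    rewrite cost'_in//; apply: powR_perturb => //; first exact: eucl_dist_ge0.
    rewrite /T; case: asboolP => [_|nDf]; first by rewrite fdist lerDl.
    apply: le_trans (eucl_distD (f z.1) _ _) _; rewrite fdist lerD2l eucl_distC.
    by apply: qdelta => // S'fx; apply: nDf.
  have dc : dist_set z.1 S `^ p <= cost z.
    apply: ge0_ler_powR => //; first exact: le_trans p1.
    by rewrite nnegrE eucl_dist_ge0.
  rewrite [X in K * X]indicE mem_set// mulr1 indicE.
  have [Az|Az] := pselect (A z).
    rewrite mem_set// mulr1; have [h _] := Asub _ Az.
    have {}h : dist_set z.1 S `^ p + eps <= cost z by [].
    by move: h Tle; move: (cost z) (cost' z) (_ `^ p) => u v w; lra.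
  rewrite (memNset Az); move: Tle dc.
  by move: (cost z) (cost' z) (_ `^ p) => u v w ? ?; rewrite mulr0; lra.
have c0 z : (0 <= (cost z)%:E)%E by rewrite lee_fin powR_ge0.
have c'0 z : (0 <= (cost' z)%:E)%E by rewrite lee_fin powR_ge0.
have ge0Ind (B : set (borel R d * borel R d)) (k : R) z : 0 <= k ->
  (0 <= (k * \1_B z)%:E)%E by move=> k0; rewrite lee_fin mulr_ge0.
have mcost : measurable_fun setT (fun z => (cost z)%:E) by exact: measurable_cost.
have : (\int[gamma]_z ((cost' z)%:E + (eps * \1_A z)%:E) <=
    \int[gamma]_z ((cost z)%:E + (K * \1_(setT `*` G) z)%:E))%E.
  apply: ae_ge0_le_integral pointwise.
  - exact: measurableT.
  - by move=> z _; apply: adde_ge0; [exact: c'0|exact: ge0Ind].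
  - by apply: emeasurable_funD; [exact: mcost'|exact: mInd].
  - by move=> z _; apply: adde_ge0; [exact: c0|exact: ge0Ind].
  - by apply: emeasurable_funD; [exact: mcost|exact: mInd].
rewrite (ge0_integralD _ measurableT (fun z _ => c'0 z) mcost'
  (fun z _ => ge0Ind A eps z eps0) (mInd A eps mA)).
rewrite (ge0_integralD _ measurableT (fun z _ => c0 z) mcost
  (fun z _ => ge0Ind _ K z K0) (mInd _ K mTG)).
rewrite (intInd A eps eps0 mA) (intInd _ K K0 mTG) gamma2// => le1.
have le2 := rerouting_cost_ge.
have cost_fin : (\int[gamma]_z (cost z)%:E < +oo)%E.
  rewrite cost_wasserstein; apply: le_lt_trans nu_fin; rewrite /relaxed_energy leeDl//.
  by rewrite mule_ge0 ?length_functional_ge0// lee_fin ltW.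
have KG_fin : (K%:E * nu G < +oo)%E.
  rewrite lte_mul_pinfty ?lee_fin//.
  by apply: le_lt_trans (probability_le1 _ _) (ltry _).
have epsA : (0 <= eps%:E * gamma A)%E by rewrite mule_ge0.
have cost'_fin : (\int[gamma]_z (cost' z)%:E \is a fin_num)%E.
  rewrite ge0_fin_numE; last by apply: integral_ge0 => z _; exact: c'0.
  apply: (@le_lt_trans _ _ (\int[gamma]_z (cost z)%:E + K%:E * nu G)%E).
    by apply: le_trans le1; rewrite leeDl.
  exact: lte_add_pinfty.
rewrite -(leeD2lE _ _ cost'_fin); apply: le_trans le1 _.
by rewrite leeD2r.
Qed.

End competitor.

(** * Half of a loop carries no excess *)

(** The bound [m_removal] is all that is retained of the transport problem: [m] is
    the mass of the pairs of [excess] as a function of their second component. *)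
Section half_loop_null.
Context (R : realType) (d : nat) (nu : probability (borel R d) R).
Variables (a kappa : R) (phi psi : R -> 'rV[R]_d).
Variable m : {measure set (borel R d) -> \bar R}.
Hypotheses (m_fin : (m setT < +oo)%E) (kappa0 : 0 <= kappa).
Hypotheses (nua : length_bound nu a) (cS : connected (supp nu)).
Hypotheses (phi_cont : {within `[-1, 1], continuous phi}).
Hypotheses (psi_cont : {within `[-1, 1], continuous psi}).
Hypotheses (phiS : phi @` `[-1, 1] `<=` supp nu).
Hypotheses (psiS : psi @` `[-1, 1] `<=` supp nu).
Hypotheses (phi_inj : forall s t : R, s \in `[-1, 1] -> t \in `[-1, 1] ->
  phi s = phi t -> s = t).
Hypotheses (psiN1 : psi (-1) = phi (-1)) (psi1 : psi 1 = phi 1).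
Hypotheses (phi_psi : forall s t : R, s \in `]-1, 1[ -> t \in `[-1, 1] ->
  phi s <> psi t).
Hypothesis m_removal : forall (S' : set 'rV[R]_d) (G : set (borel R d))
    (q x0 x1 : 'rV[R]_d) (delta : R),
  closed S' -> connected S' -> S' `<=` supp nu ->
  S' x0 -> S' x1 -> x0 <> x1 ->
  measurable G -> supp nu `\` G `<=` S' -> hausdorff1 (S' `&` G) = 0%E ->
  S' q -> 0 <= delta -> delta <= 1 ->
  (forall e, supp nu e -> ~ S' e -> eucl_dist q e <= delta) ->
  (m G <= (kappa * delta)%:E * nu G)%E.

Let N11 : -1 <= 1 :> R. Proof. by apply: (@le_trans _ _ 0); rewrite ?lerN10. Qed.

Let phi_ne : phi (-1) <> phi 1.
Proof. by apply: (@phi_ends _ _ _ phi_inj (-1) 1) => //; rewrite gtrN. Qed.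

Let closure_suppS : closure (supp nu) = supp nu.
Proof. by rewrite -(closure_id _).1//; exact: closed_supp. Qed.

(** A point is H^1-null, so its mass can be moved without removing anything from
    the support. *)
Lemma atomless_on_supp y : supp nu y -> m [set y] = 0%E.
Proof.
move=> Sy; apply/eqP; rewrite eq_le measure_ge0 andbT.
have my : measurable ([set y] : set (borel R d)).
  by apply: closed_borel; exact: closed_point.
have := @m_removal (supp nu) [set y] y (phi (-1)) (phi 1) 0.
rewrite mulr0 mul0e; apply => //.
- exact: closed_supp.
- by apply: phiS; exists (-1) => //=; rewrite in_itv/= lexx.
- by apply: phiS; exists 1 => //=; rewrite in_itv/= lexx N11.
- exact: hausdorff1_setI1.
Qed.

(** The condition -1 <= u <= 1 is kept apart from u <= s so that [J] makes sense for
    every real s, in particular slightly above 1. *)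
Let J (s : R) : set (borel R d) := [set phi u | u in [set u | -1 <= u <= 1 /\ u <= s]].

Let mJ s : measurable (J s).
Proof.
rewrite (_ : J s = phi @` `[-1, Num.min s 1]).
  by apply: closed_borel; apply: closed_phi_itv => //; rewrite ge_min lexx orbT.
apply/seteqP; split => [_ [u [/andP[u1 u2] us] <-]|_ [u /= + <-]].
  by exists u => //=; rewrite in_itv/= u1 le_min us.
by rewrite in_itv/= le_min => /and3P[u1 us u2]; exists u => //=; rewrite u1.
Qed.

Let J_le s t : s <= t -> J s `<=` J t.
Proof. by move=> st _ [u [u1 us] <-]; exists u => //; split => //; exact: le_trans st. Qed.

Let mJ_le s t : s <= t -> (m (J s) <= m (J t))%E.
Proof. by move=> st; apply: le_measure; rewrite ?inE//; exact: J_le. Qed.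

Let m_lty A : measurable A -> (m A < +oo)%E.
Proof.
by move=> mA; apply: le_lt_trans m_fin; apply: le_measure; rewrite ?inE.
Qed.

Let phi_supp u : -1 <= u <= 1 -> supp nu (phi u).
Proof. by move=> u1; apply: phiS; exists u => //=; rewrite in_itv. Qed.

Let mJN1 : m (J (-1)) = 0%E.
Proof.
rewrite (_ : J (-1) = [set phi (-1)]).
  by apply: atomless_on_supp; apply: phi_supp; rewrite lexx.
apply/seteqP; split => [_ [u [/andP[u1 _] uN1] <-]|_ ->]; last first.
  by exists (-1) => //=; rewrite !lexx N11.
by congr phi; apply/eqP; rewrite eq_le u1 uN1.
Qed.

(** The intermediate value theorem for the mass of [J t], which is continuous in
    t as [m] has no atoms on the arc: at the supremum t of the s with m (J s) <= v,
    approximation from the left gives one inequality and from the right the other. *)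
Lemma ex_arc_level (v : \bar R) : (0 <= v)%E -> (v <= m (J 1))%E ->
  exists2 t, -1 <= t <= 1 & m (J t) = v.
Proof.
move=> v0 v1.
pose E := [set s | s <= 1 /\ (m (J s) <= v)%E].
have EN1 : E (-1) by split => //; rewrite mJN1.
have Eub : has_ubound E by exists 1 => s [].
have supE : has_sup E by split => //; exists (-1).
pose t := sup E.
have t1 : -1 <= t <= 1.
  apply/andP; split; first exact: ub_le_sup.
  by apply: ge_sup; [exists (-1)|move=> s []].
exists t => //; apply/eqP; rewrite eq_le; apply/andP; split.
- pose V n := J (t - n.+1%:R^-1).
  have mV : measurable (\bigcup_n V n).
    by apply: bigcupT_measurable => n; exact: mJ.
  have mt : measurable ([set phi t] : set (borel R d)).
    by apply: closed_borel; exact: closed_point.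
  apply: (@le_trans _ _ (m (\bigcup_n V n `|` [set phi t]))).
    apply: le_measure; rewrite ?inE//; first exact: measurableU.
    move=> _ [u [u1 ut] <-].
    have [->|tu] := eqVneq u t; first by right.
    left; exists (Num.bound (t - u)^-1) => //.
    exists u => //; split => //.
    have tu0 : 0 < t - u by rewrite subr_gt0 lt_neqAle tu.
    by rewrite lerBrDr -lerBrDl ltW// invr_boundS_lt.
  apply: (le_trans (measureU2 _ _ _)) => //.
  rewrite [X in (_ + X)%E](atomless_on_supp (phi_supp t1)) adde0.
  have ndV : nondecreasing_seq V.
    apply/nondecreasing_seqP => n; apply/subsetPset; apply: J_le.
    by rewrite lerD2l lerN2 lef_pV2 ?posrE// ler_nat.
  have cvgV := @nondecreasing_cvg_mu _ _ _ m V (fun n => mJ _) mV ndV.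
  apply: cvge_le cvgV; apply: nearW => n /=.
  have [s [_ sv] ts] : exists2 s, E s & t - n.+1%:R^-1 < s.
    by apply: sup_adherent => //; rewrite invr_gt0.
  by apply: le_trans sv; apply: mJ_le; exact: ltW.
- have above u : t < u -> (v <= m (J u))%E.
    move=> tu; have [u1|u1] := leP u 1; last by apply: le_trans v1 _; apply: mJ_le; exact: ltW.
    rewrite leNgt; apply/negP => uv; move: tu; rewrite ltNge => /negP; apply.
    by apply: ub_le_sup => //; split => //; exact: ltW.
  pose V n := J (t + n.+1%:R^-1).
  have capV : \bigcap_n V n = J t.
    apply/seteqP; split => [x Vx|x Jx n _]; last first.
      by apply: J_le Jx; rewrite lerDl invr_ge0.
    have [u [u1 _] ux] := Vx 0%N I.
    exists u => //; split => //; apply/ler_addgt0Pr => e e0.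
    pose n := Num.bound e^-1.
    have [w [w1 wt] wx] := Vx n I.
    have -> : u = w by apply: phi_inj; rewrite ?in_itv// ux wx.
    by apply: le_trans wt _; rewrite lerD2l ltW// invr_boundS_lt.
  have niV : nonincreasing_seq V.
    apply/nonincreasing_seqP => n; apply/subsetPset; apply: J_le.
    by rewrite lerD2l lef_pV2 ?posrE// ler_nat.
  have mcapV : measurable (\bigcap_n V n) by rewrite capV.
  have := @nonincreasing_cvg_mu _ _ _ m V (m_lty (mJ _)) (fun n => mJ _) mcapV niV.
  rewrite capV => cvgV.
  apply: cvge_ge cvgV; apply: nearW => n /=; apply: above.
  by rewrite ltrDl invr_gt0.
Qed.

Let G s t : set (borel R d) := supp nu `\` arc_rest (supp nu) phi s t.

Let mG s t : -1 <= s -> s < t -> t <= 1 -> measurable (G s t).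
Proof.
move=> s1 st t1; apply: measurableD.
  by apply: closed_borel; exact: closed_supp.
exact: measurable_arc_rest.
Qed.

(** Removal of the open arc ]s, t[ with delta = a nu(G s t).  Only the closed sub-arc
    [K] is required to be cleared, since [closure C] may meet the open arc; the set
    [G0] to be rerouted is [K] and what lies outside [closure C]. *)
Lemma arc_removal_bound s s' t' t : -1 <= s -> s < s' -> s' < t' -> t' < t ->
  t <= 1 -> a * fine (nu (G s t)) <= 1 ->
  (m (phi @` `[s', t']) <= (kappa * a * fine (nu (G s t)) ^+ 2)%:E)%E.
Proof.
move=> s1 ss' st' t't t1 small.
have st : s < t := lt_trans ss' (lt_trans st' t't).
set C := arc_rest (supp nu) phi s t.
have CS : C `<=` supp nu by move=> y /connected_component_sub[].
have clCS : closure C `<=` supp nu by rewrite -closure_suppS; exact: closureS.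
set K : set (borel R d) := phi @` `[s', t'].
have mK : measurable K.
  apply: closed_borel; apply: closed_phi_itv => //.
    exact: le_trans s1 (ltW ss').
  exact: le_trans (ltW t't) t1.
have mclC : measurable (closure C : set (borel R d)).
  by apply: closed_borel; exact: closed_closure.
pose G0 : set (borel R d) := (supp nu `\` closure C) `|` K.
have mG0 : measurable G0.
  apply: measurableU => //; apply: measurableD => //.
  by apply: closed_borel; exact: closed_supp.
have KG : K `<=` G s t.
  move=> y [u]; rewrite /= in_itv/= => /andP[u1 u2] <-; split.
    apply: phi_supp; rewrite (le_trans s1 (le_trans (ltW ss') u1)).
    exact: le_trans u2 (le_trans (ltW t't) t1).
  move=> /connected_component_sub[_]; apply; exists u => //=.
  by rewrite in_itv/= (lt_le_trans ss' u1) (le_lt_trans u2 t't).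
have G0G : G0 `<=` G s t.
  move=> y [[Sy Cy]|/KG//]; split => // Cy'; apply: Cy; exact: subset_closure.
have nuG : (nu (G s t) \is a fin_num)%E.
  by apply: fin_num_measure; exact: mG.
have first_C := arc_rest_first phi_cont psi_cont phiS psiS phi_inj psiN1 psi1
  phi_psi s1 st t1.
have last_C := arc_rest_last phi_cont psi_cont phiS psiS phi_inj psiN1 psi1
  phi_psi s1 st t1.
have start_C := arc_rest_start phi_cont psi_cont phiS psiS phi_inj psiN1 psi1
  phi_psi s1 st t1.
have le1 : (m G0 <= (kappa * (a * fine (nu (G s t))))%:E * nu G0)%E.
  apply: (@m_removal (closure C) G0 (phi s) (phi (-1)) (phi 1)) => //.
  - exact: closed_closure.
  - by apply: connected_closure; exact: component_connected.
  - exact: subset_closure.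
  - exact: subset_closure.
  - move=> y [Sy nG0]; apply: contrapT => Cy; by apply: nG0; left.
  - apply/eqP; rewrite eq_le hausdorff1_ge0 andbT.
    rewrite -(arc_rest_closure_null nua phi_cont psi_cont phiS psiS phi_inj
      psiN1 psi1 phi_psi s1 st t1 ss' t't).
    by apply: hausdorff1_le => y [Cy [[_ /(_ Cy)]|Ky]].
  - exact: subset_closure.
  - by rewrite mulr_ge0 ?fine_ge0//; exact: nua.1.
  - move=> e Se Ce; rewrite -lee_fin EFinM fineK//.
    apply: (arc_rest_dist nua cS phi_cont phiS phi_inj s1 st t1 Se).
    by move=> /subset_closure.
apply: (@le_trans _ _ (m G0)).
  by apply: le_measure; rewrite ?inE//; right.
apply: le_trans le1 _.
have nuG0 : (nu G0 <= (fine (nu (G s t)))%:E)%E.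
  by rewrite fineK//; apply: le_measure; rewrite ?inE//; exact: mG.
apply: (@le_trans _ _ ((kappa * (a * fine (nu (G s t))))%:E *
    (fine (nu (G s t)))%:E)%E).
  apply: lee_wpmul2l => //; rewrite lee_fin !mulr_ge0 ?fine_ge0//.
  exact: nua.1.
by rewrite -EFinM lee_fin expr2 !mulrA.
Qed.

(** The arc is cut at 3n + 1 points into arcs of equal mass w.  The arcs between the
    points of indices 3i and 3i + 3 remove disjoint sets, one of which has nu-mass at
    most 1 / n, and its middle third has mass w = M / (3n). *)
Let m_J1 : m (J 1) = 0%E.
Proof.
pose M := fine (m (J 1)).
have ME : m (J 1) = M%:E by rewrite /M fineK// ge0_fin_numE// m_lty.
have M0 : 0 <= M by rewrite /M fine_ge0.
have [M_eq0|M_gt0] := eqVneq M 0; first by rewrite ME M_eq0.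
have {M0}M_gt0 : 0 < M by rewrite lt_neqAle eq_sym M_gt0.
exfalso.
have a0 : 0 <= a := nua.1.
(* n >= a makes a nu(G) <= 1 in [arc_removal_bound]; n > 3 kappa a / M is the
   contradiction *)
pose n := (Num.bound (a + 3 * kappa * a / M)).+1.
have n_gt : a + 3 * kappa * a / M < n%:R.
  apply: (@lt_trans _ _ (Num.bound (a + 3 * kappa * a / M))%:R).
    by apply: archi_boundP; rewrite addr_ge0// divr_ge0 ?mulr_ge0// ltW.
  by rewrite ltr_nat.
have n0 : 0 < n%:R :> R by rewrite ltr0n.
have kaM0 : 0 <= 3 * kappa * a / M by rewrite divr_ge0 ?mulr_ge0// ltW.
pose w := M / (3 * n)%:R.
have w0 : 0 < w by rewrite divr_gt0// ltr0n.
have wn : (3 * n)%:R * w = M by rewrite mulrC divfK// pnatr_eq0.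
have lev k : exists t, (k <= 3 * n)%N ->
    -1 <= t <= 1 /\ m (J t) = (k%:R * w)%:E.
  have [kn|kn] := leqP k (3 * n); last by exists 0.
  have [||t t1 mt] := @ex_arc_level (k%:R * w)%:E; last by exists t.
    by rewrite lee_fin mulr_ge0// ltW.
  by rewrite ME lee_fin -wn ler_pM2r// ler_nat.
have [t tP] := choice lev.
have t_lt i j : (i < j)%N -> (j <= 3 * n)%N -> t i < t j.
  move=> ij jn; rewrite ltNge; apply/negP => /mJ_le.
  rewrite (tP _ jn).2 (tP _ (ltnW (leq_trans ij jn))).2 lee_fin ler_pM2r//.
  by rewrite ler_nat leqNgt ij.
have t_itv i : (i <= 3 * n)%N -> -1 <= t i <= 1 by move=> /tP[].
have t_le i j : (i <= j)%N -> (j <= 3 * n)%N -> t i <= t j.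
  by rewrite leq_eqVlt => /predU1P[->//|ij] jn; apply/ltW/t_lt.
pose H i := G (t (3 * i)%N) (t (3 * i.+1)%N).
have lt3 (i : 'I_n) : (3 * i.+1 <= 3 * n)%N by rewrite leq_mul2l ltn_ord.
have lt3' (i : 'I_n) : (3 * i <= 3 * n)%N by rewrite leq_mul2l ltnW// ltn_ord.
have mH (i : 'I_n) : measurable (H i).
  apply: mG.
  - by have /andP[] := t_itv _ (lt3' i).
  - by apply: t_lt => //; rewrite ltn_pmul2l.
  - by have /andP[] := t_itv _ (lt3 i).
have HI i j : (i < j)%N -> (j < n)%N -> H i `&` H j = set0.
  move=> ij jn; have ni : (i < n)%N := ltn_trans ij jn.
  have /andP[i1 _] := t_itv _ (lt3' (Ordinal ni)).
  have /andP[_ j1] := t_itv _ (lt3 (Ordinal jn)).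
  apply: (arc_rest_disjoint cS phi_cont psi_cont phiS psiS phi_inj psiN1 psi1
    phi_psi) => //.
  - by apply: t_lt; [rewrite ltn_pmul2l|exact: (lt3 (Ordinal ni))].
  - by apply: t_le; [rewrite leq_pmul2l|exact: (lt3' (Ordinal jn))].
  - by apply: t_lt; [rewrite ltn_pmul2l|exact: (lt3 (Ordinal jn))].
have tH : trivIset setT (fun i : 'I_n => H i).
  apply/trivIsetP => i j _ _ ij.
  have [lt_ij|] := ltnP i j; first exact: HI.
  rewrite leq_eqVlt => /predU1P[ji|lt_ji]; last by rewrite setIC; exact: HI.
  by move: ij; rewrite (_ : i = j) ?eqxx//; apply: val_inj.
have sum_le : \sum_(i < n) fine (nu (H i)) <= 1.
  rewrite -lee_fin -sumEFin.
  rewrite (eq_bigr (fun i : 'I_n => nu (H i))); last first.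
    by move=> i _; rewrite fineK//; exact: fin_num_measure.
  rewrite -(measure_bigsetU_ord nu xpredT mH tH).
  by apply: probability_le1; apply: bigsetU_measurable => i _; exact: mH.
have [i Hi] : exists i : 'I_n, fine (nu (H i)) <= n%:R^-1.
  apply: contrapT => /forallNP big.
  move: sum_le; rewrite leNgt => /negP; apply.
  have -> : 1 = \sum_(i < n) n%:R^-1 :> R.
    by rewrite sumr_const card_ord -[RHS]mulr_natl mulfV// gt_eqF.
  apply: ltr_sum => [|j _].
    by apply/hasP; exists ord0 => //; rewrite mem_index_enum.
  by have := big j => /negP; rewrite -ltNge.
have i2 : ((3 * i).+2 < 3 * i.+1)%N by rewrite mulnS.
have ss' : t (3 * i)%N < t (3 * i).+1.
  by apply: t_lt => //; apply: leq_trans (lt3 i); rewrite mulnS addnC addn3 ltnW.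
have st' : t (3 * i).+1 < t (3 * i).+2.
  by apply: t_lt => //; apply: leq_trans (lt3 i); exact: ltnW.
have t't : t (3 * i).+2 < t (3 * i.+1)%N by apply: t_lt.
have /andP[s1 _] := t_itv _ (lt3' i).
have /andP[_ t1] := t_itv _ (lt3 i).
have Hi0 : 0 <= fine (nu (H i)) by exact: fine_ge0.
have small : a * fine (nu (H i)) <= 1.
  apply: le_trans (ler_wpM2l a0 Hi) _; rewrite ler_pdivrMr// mul1r ltW//.
  by apply: le_lt_trans n_gt; rewrite lerDl.
have bound := arc_removal_bound s1 ss' st' t't t1 small.
have w_le : (w%:E <= m (phi @` `[t (3 * i).+1, t (3 * i).+2]))%E.
  have n1 : ((3 * i).+1 <= 3 * n)%N.
    by apply: leq_trans (lt3 i); rewrite mulnS addnC addn3 ltnW.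
  have n2 : ((3 * i).+2 <= 3 * n)%N by apply: leq_trans (lt3 i); exact: ltnW.
  have mK : measurable (phi @` `[t (3 * i).+1, t (3 * i).+2] : set (borel R d)).
    apply: closed_borel; apply: closed_phi_itv => //.
      by have /andP[] := t_itv _ n1.
    by have /andP[] := t_itv _ n2.
  have : (m (J (t (3 * i).+2)) <= m (J (t (3 * i).+1)) +
      m (phi @` `[t (3 * i).+1, t (3 * i).+2]))%E.
    apply: le_trans (measureU2 _ _ _) => //.
    apply: le_measure; rewrite ?inE//; first exact: measurableU.
    move=> _ [u [u1 ut] <-]; have [us|us] := leP u (t (3 * i).+1).
      by left; exists u.
    by right; exists u => //=; rewrite in_itv/= (ltW us).
  rewrite (tP _ n1).2 (tP _ n2).2 -addn1 natrD mulrDl mul1r EFinD.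
  by rewrite leeD2lE.
have w_le_sqr : w <= kappa * a * n%:R^-1 ^+ 2.
  rewrite -lee_fin; apply: le_trans w_le (le_trans bound _).
  rewrite lee_fin ler_wpM2l ?mulr_ge0// ler_pXn2r// nnegrE.
  by rewrite invr_ge0 ltW.
have : n%:R <= 3 * kappa * a / M.
  rewrite ler_pdivlMr// -wn natrM.
  have -> : 3 * kappa * a = n%:R * (3 * n%:R * (kappa * a * n%:R^-1 ^+ 2)).
    by field; rewrite gt_eqF.
  by rewrite !ler_pM2l// mulr_gt0.
move=> /(lt_le_trans n_gt); rewrite ltNge => /negP; apply.
by rewrite lerDr.
Qed.

Lemma half_loop_null : m (phi @` `[-1, 1]) = 0%E.
Proof.
rewrite -m_J1; congr (m _); apply/seteqP; split => [_ [u /= u1 <-]|_ [u [u1 _] <-]].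
  by move: u1; rewrite in_itv/= => /andP[u1 u2]; exists u => //=; rewrite u1.
by exists u => //=; rewrite in_itv.
Qed.

End half_loop_null.

(** * Cutting a loop into two half loops *)

Lemma ex_restricted_pushforward (R : realType) d1 d2 (T1 : measurableType d1)
    (T2 : measurableType d2) (P : probability T1 R) (E : set T1) (f : T1 -> T2) :
  measurable E -> measurable_fun setT f ->
  exists m : {measure set T2 -> \bar R}, forall A, m A = P (f @^-1` A `&` E).
Proof.
move=> mE mf; pose P' : {measure set T1 -> \bar R} := mrestr P mE.
by unshelve eexists (pushforward P' f).
Qed.

Lemma within_continuous_comp_fun (T U V : topologicalType) (A : set T)
    (B : set U) (f : T -> U) (g : U -> V) :
  set_fun A B f -> {within A, continuous f} -> {within B, continuous g} ->
  {within A, continuous (g \o f)}.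
Proof.
move=> AB /subspace_continuousP cf /subspace_continuousP cg.
apply/subspace_continuousP => x Ax W gW.
have BW : nbhs (f x) [set y | B y -> W (g y)] := cg _ (AB _ Ax) W gW.
have : nbhs x [set y | A y -> B (f y) -> W (g (f y))] := cf x Ax _ BW.
by apply: filterS => y h Ay; apply: h => //; exact: AB.
Qed.

Section half_circle.
Context (R : realType).

(** The graph of +/- sqrt (1 - t^2), with sign [e]: an algebraic parametrisation of
    each half circle. *)
Definition half_circle (e t : R) : 'rV[R]_2 :=
  t *: delta_mx ord0 ord0 + (e * Num.sqrt (1 - t ^+ 2)) *: delta_mx ord0 ord_max.

Lemma half_circle0 e t : half_circle e t ord0 ord0 = t.
Proof. by rewrite !mxE/= mulr1 mulr0 addr0. Qed.

Lemma half_circle1 e t :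
  half_circle e t ord0 ord_max = e * Num.sqrt (1 - t ^+ 2).
Proof. by rewrite !mxE/= mulr1 mulr0 add0r. Qed.

Lemma continuous_half_circle e : continuous (half_circle e).
Proof.
move=> t; apply: (@continuousD _ _ _ (fun t : R => t *: delta_mx ord0 ord0)
  (fun t => (e * Num.sqrt (1 - t ^+ 2)) *: delta_mx ord0 ord_max)).
  exact: scalel_continuous.
apply: continuousZr_tmp.
apply: (@continuous_comp _ _ _ (fun t : R => Num.sqrt (1 - t ^+ 2)) (fun s => e * s));
  last exact: mulrl_continuous.
apply: (@continuous_comp _ _ _ (fun t : R => 1 - t ^+ 2) Num.sqrt);
  last exact: sqrt_continuous.
apply: (@continuousB _ R R (fun=> 1 : R) (fun t : R => t ^+ 2)).
  exact: cst_continuous.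
exact: exprn_continuous.
Qed.

Lemma circleP (z : 'rV[R]_2) :
  circle z <-> z ord0 ord0 ^+ 2 + z ord0 ord_max ^+ 2 = 1.
Proof.
rewrite /circle/= /eucl_norm big_ord_recl big_ord1.
rewrite (_ : lift ord0 ord0 = ord_max); last exact: val_inj.
split=> [z1|->]; last by rewrite sqrtr1.
by rewrite -[LHS]sqr_sqrtr ?z1 ?expr1n// addr_ge0 ?sqr_ge0.
Qed.

Lemma itv_sqr_le (t : R) : t \in `[-1, 1] -> 0 <= 1 - t ^+ 2.
Proof.
rewrite in_itv/= => t1; rewrite subr_ge0 -real_normK ?num_real//.
by rewrite expr_le1// ler_norml.
Qed.

Lemma half_circle_circle e t : e ^+ 2 = 1 -> t \in `[-1, 1] ->
  circle (half_circle e t).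
Proof.
move=> e1 t1; apply/circleP; rewrite half_circle0 half_circle1 exprMn e1 mul1r.
by rewrite sqr_sqrtr ?itv_sqr_le// addrC subrK.
Qed.

Lemma circle_half_circle z : circle z -> exists2 t, t \in `[-1, 1] &
  z = half_circle 1 t \/ z = half_circle (-1) t.
Proof.
move=> /circleP z1; exists (z ord0 ord0).
  rewrite in_itv/= -ler_norml -(@ler_pXn2r _ 2) ?nnegrE// expr1n real_normK ?num_real//.
  by rewrite -z1 lerDl sqr_ge0.
have sq : Num.sqrt (1 - z ord0 ord0 ^+ 2) = `|z ord0 ord_max|.
  by rewrite -z1 addrC addKr sqrtr_sqr.
have eqz (u : 'rV[R]_2) : u ord0 ord0 = z ord0 ord0 -> u ord0 ord_max = z ord0 ord_max ->
    z = u.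
  move=> u0 u1; apply/rowP => i; case: (unliftP ord0 i) => [j ->|->//].
  by rewrite ord1 (_ : lift ord0 ord0 = ord_max)//; exact: val_inj.
have [z0|z0] := leP 0 (z ord0 ord_max).
  by left; apply: eqz; rewrite ?half_circle0// half_circle1 sq mul1r ger0_norm.
right; apply: eqz; rewrite ?half_circle0// half_circle1 sq mulN1r.
by rewrite ltr0_norm// opprK.
Qed.

End half_circle.

Lemma loop_half_loops (R : realType) d (Gamma : set 'rV[R]_d) : loop Gamma ->
  exists phi : R -> R -> 'rV[R]_d, [/\
    forall e, e ^+ 2 = 1 -> {within `[-1, 1], continuous (phi e)},
    forall e, e ^+ 2 = 1 -> phi e @` `[-1, 1] `<=` Gamma,
    forall y, Gamma y -> exists e, e ^+ 2 = 1 /\ (phi e @` `[-1, 1]) y,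
    forall e (s t : R), e ^+ 2 = 1 -> s \in `[-1, 1] -> t \in `[-1, 1] ->
      phi e s = phi e t -> s = t &
    forall e, e ^+ 2 = 1 -> [/\ phi (- e) (-1) = phi e (-1),
      phi (- e) 1 = phi e 1 &
      forall s t : R, s \in `]-1, 1[ -> t \in `[-1, 1] ->
        phi e s <> phi (- e) t]].
Proof.
move=> [f [g [cf cg fG gC [fK gK]]]].
have f_inj z w : circle z -> circle w -> f z = f w -> z = w.
  by move=> Cz Cw zw; rewrite -(fK z) ?inE// zw fK// inE.
exists (fun e t => f (half_circle e t)); split.
- move=> e e1; apply: within_continuous_comp_fun cf.
    by move=> t t1; exact: half_circle_circle.
  exact/continuous_subspaceT/continuous_half_circle.
- by move=> e e1 _ [t t1 <-]; apply: fG; exact: half_circle_circle.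
- move=> y Gy; have [t t1 gy] := circle_half_circle (gC _ Gy).
  have fgy : f (g y) = y by apply: gK; rewrite inE.
  case: gy => gy; [exists 1|exists (-1)]; rewrite ?expr1n ?sqrrN ?expr1n; split => //;
    by exists t => //; rewrite -gy.
- move=> e s t e1 s1 t1 /f_inj.
  move=> /(_ (half_circle_circle e1 s1) (half_circle_circle e1 t1)) st.
  by rewrite -(half_circle0 e s) st half_circle0.
- move=> e e1; have eN1 : (- e) ^+ 2 = 1 by rewrite sqrrN.
  split.
  + by rewrite /half_circle sqrrN expr1n subrr sqrtr0 !mulr0.
  + by rewrite /half_circle expr1n subrr sqrtr0 !mulr0.
  + move=> s t s1 t1 /f_inj.
    have s11 : s \in `[-1, 1] by apply: subset_itv_oo_cc.
    move=> /(_ (half_circle_circle e1 s11) (half_circle_circle eN1 t1)) st.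
    have := half_circle0 e s; rewrite st half_circle0 => ts.
    have := half_circle1 e s; rewrite st half_circle1 ts mulNr => /eqP.
    rewrite eq_sym -addr_eq0 -mulr2n mulrn_eq0/= mulf_eq0 => /orP[/eqP e0|].
      by move: e1; rewrite e0 expr0n/= => /eqP; rewrite eq_sym oner_eq0.
    rewrite sqrtr_eq0 subr_le0 leNgt => /negP; apply.
    rewrite -real_normK ?num_real// expr_lt1// ltr_norml.
    by move: s1; rewrite in_itv.
Qed.

(** * The minimal energy is finite *)

Lemma ae_eucl_norm_le (R : realType) d (mu : probability (borel R d) R) :
  compact (supp mu) -> exists M, {ae mu, forall x, eucl_norm x <= M}.
Proof.
move=> cmu.
have : compact (@eucl_norm R d @` supp mu).
  apply: continuous_compact => //.
  exact/continuous_subspaceT/continuous_eucl_norm.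
move=> /compact_bounded[M [_ /(_ (M + 1))]]; rewrite ltrDl => /(_ ltr01) bM.
exists (M + 1); apply: (@filterS _ _ (ae_filter_ringOfSetsType mu) _ _ _ (ae_supp mu)).
move=> x Sx; apply: le_trans (ler_norm _) _; apply: bM; by exists x.
Qed.

(** Compare with the Dirac mass at 0, whose support is a point and has no length. *)
Lemma minimizer_energy_lty (R : realType) d (p Lambda : R)
    (rho0 nu : probability (borel R d) R) : 1 <= p ->
  compact (supp rho0) -> relaxed_minimizer p Lambda rho0 nu ->
  (relaxed_energy p Lambda rho0 nu < +oo)%E.
Proof.
move=> p1 crho0 [_ nu_min].
have p0 : 0 <= p by exact: le_trans p1.
have [M rhoM] := ae_eucl_norm_le crho0.
have m0 : measurable_fun [set: borel R d] (fun=> 0 : borel R d).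
  exact: measurable_cst.
have mg : measurable_fun [set: borel R d]
    (fun x : borel R d => (x, 0 : borel R d)).
  by apply: measurable_fun_pair => //; exact: measurable_id.
have [nu' [nu'E nu'int]] := ex_pushforward rho0 m0.
have [Q [QE Qint]] := ex_pushforward rho0 mg.
have mnorm : measurable_fun [set: borel R d]
    (fun x : borel R d => (eucl_norm x `^ p)%:E).
  apply/measurable_EFinP; apply: (measurableT_comp (measurable_powR p)).
  by apply: continuous_borel_measurable; exact: continuous_eucl_norm.
have int_bound (c : R) : 0 <= c -> (\int[rho0]_x (cst c%:E) x < +oo)%E.
  move=> c0; rewrite integral_cst// lte_mul_pinfty// ?lee_fin//.
  by apply: le_lt_trans (probability_le1 _ _) (ltry _).
have nu'_moment : finite_moment p nu'.
  rewrite /finite_moment nu'int//; last by move=> y; rewrite lee_fin powR_ge0.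
  by apply: int_bound; exact: powR_ge0.
have nu'0 : supp nu' `<=` [set 0].
  apply: supp_sub_closed; [exact: closed_point|rewrite nu'E].
  by rewrite (_ : _ @^-1` _ = set0)// -subset0 => x /=; apply.
have supp0 : supp nu' = [set 0].
  apply/seteqP; split => // x ->.
  by have [y Sy] := supp_nonempty nu'; rewrite -(nu'0 _ Sy).
have L0 : (length_functional nu' <= 0)%E.
  rewrite /length_functional supp0 asboolT; last exact: connected1.
  apply: ereal_inf_lbound; exists 0 => //; split=> // B mB.
  by rewrite supp0 mul0e setIC hausdorff1_setI1.
have Qcoup : coupling rho0 nu' Q.
  split=> [A mA|B mB]; rewrite QE ?nu'E.
    by congr (rho0 _); apply/seteqP; split => x /=; [case|].
  by congr (rho0 _); apply/seteqP; split => x /=; [case|].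
have W_lt : (wasserstein_pow p rho0 nu' < +oo)%E.
  apply: (@le_lt_trans _ _ (transport_cost p Q)).
    by apply: ereal_inf_lbound; exists Q.
  have := Qint _ (@measurable_cost R d p) (fun z => powR_ge0 _ _).
  rewrite /transport_cost => ->.
  apply: (@le_lt_trans _ _ (\int[rho0]_x (cst ((Num.max 0 M) `^ p)%:E) x)%E).
    apply: ae_ge0_le_integral => //.
    - by move=> x _; rewrite lee_fin powR_ge0.
    - exact: (measurableT_comp (@measurable_cost R d p) mg).
    - by move=> x _; rewrite lee_fin powR_ge0.
    - apply: (@filterS _ _ (ae_filter_ringOfSetsType rho0) _ _ _ rhoM) => x xM _.
      rewrite lee_fin; apply: ge0_ler_powR => //.
      + by rewrite nnegrE eucl_dist_ge0.
      + by rewrite nnegrE le_max lexx.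
      + by rewrite /eucl_dist subr0 le_max xM orbT.
  by apply: int_bound; exact: powR_ge0.
apply: le_lt_trans (nu_min nu' nu'_moment) _.
apply: lte_add_pinfty => //; apply: (@le_lt_trans _ _ 0%E) => //.
have -> : length_functional nu' = 0%E.
  by apply/eqP; rewrite eq_le L0 length_functional_ge0.
by rewrite mule0.
Qed.

(** * Optimal plans project onto the support along loops *)

Theorem proposition3p1 (R : realType) (d : nat) (p Lambda : R)
  (rho0 nu : probability (borel R d) R)
  (pi_Sigma : borel R d -> borel R d)
  (gamma : probability (borel R d * borel R d)%type R)
  (Gamma : set 'rV[R]_d)
  (hp : 1 <= p) (hLambda : 0 < Lambda)
  (hrho0 : compact (supp rho0))
  (hnu : relaxed_minimizer p Lambda rho0 nu)
  (hpi : measurable_selection_ae rho0 (argmin_dist (supp nu)) pi_Sigma)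
  (hgamma : optimal_plan p rho0 nu gamma)
  (hGamma : Gamma `<=` supp nu) (hloop : loop Gamma) :
  {ae gamma, forall z, Gamma z.2 ->
    eucl_dist z.1 z.2 = dist_set z.1 (supp nu)}.
Proof.
have nu_fin := minimizer_energy_lty hp hrho0 hnu.
have L_lty : (length_functional nu < +oo)%E.
  rewrite ltNge leye_eq; apply/negP => /eqP Ly; move: nu_fin.
  rewrite /relaxed_energy Ly gt0_muley ?lte_fin// addey ?ltxx//.
  by rewrite gt_eqF// (lt_le_trans _ (wasserstein_pow_ge0 _ _ _))// ltNy0.
have cS : connected (supp nu).
  by apply: contrapT => ncS; move: L_lty; rewrite /length_functional asboolF ?ltxx.
have [a nua] : exists a, length_bound nu a.
  apply: contrapT => /forallNP noa; move: L_lty.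
  rewrite /length_functional asboolT// (_ : [set _ | _ in _] = set0).
    by rewrite ereal_inf0 ltxx.
  by apply/seteqP; split => // x [a /noa].
have [M rhoM] := ae_eucl_norm_le hrho0.
have S0 := supp_nonempty nu; have [y0 Sy0] := S0.
have rho0M : {ae rho0, forall x, dist_set x (supp nu) <= M + eucl_norm y0}.
  apply: (@filterS _ _ (ae_filter_ringOfSetsType rho0) _ _ _ rhoM) => x xM.
  apply: le_trans (dist_set_le x Sy0) _; apply: le_trans (ler_eucl_normD _ _) _.
  by rewrite eucl_normN lerD2r.
have [D [mD D0 mf f_argmin]] := hpi.
have [phi [phi_cont phiG Gphi phi_inj phi_psi]] := loop_half_loops hloop.
have mGamma : measurable (Gamma : set (borel R d)).
  rewrite (_ : Gamma = phi 1 @` `[-1, 1] `|` phi (-1) @` `[-1, 1]).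
    by apply: measurableU; apply: closed_borel; apply: closed_phi_itv => //;
      apply: phi_cont; rewrite ?sqrrN expr1n.
  apply/seteqP; split => [y /Gphi[e [/eqP]]|y [|]].
  - by rewrite sqrf_eq1 => /orP[] /eqP -> y1; [left|right].
  - by apply: phiG; rewrite expr1n.
  - by apply: phiG; rewrite sqrrN expr1n.
have null eps : 0 < eps ->
    gamma (excess p eps (supp nu) `&` (setT `*` Gamma)) = 0%E.
  move=> eps0; have mE := measurable_excess p eps S0.
  have [m mE'] := ex_restricted_pushforward gamma mE measurable_snd.
  pose kappa := (M + eucl_norm y0 + 1) `^ p / eps.
  have kappa0 : 0 <= kappa by rewrite divr_ge0 ?powR_ge0// ltW.
  have m_lty : (m setT < +oo)%E.
    rewrite mE' preimage_setT setTI.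
    exact: le_lt_trans (probability_le1 gamma mE) (ltry _).
  have removal (S' : set 'rV[R]_d) (G : set (borel R d)) q x0 x1 delta :
      closed S' -> connected S' -> S' `<=` supp nu ->
      S' x0 -> S' x1 -> x0 <> x1 ->
      measurable G -> supp nu `\` G `<=` S' -> hausdorff1 (S' `&` G) = 0%E ->
      S' q -> 0 <= delta -> delta <= 1 ->
      (forall e, supp nu e -> ~ S' e -> eucl_dist q e <= delta) ->
      (m G <= (kappa * delta)%:E * nu G)%E.
    move=> cS' coS' S'S S'0 S'1 x01 mG SG S'G S'q delta0 delta1 qdelta.
    have := excess_bound hp hLambda hnu nu_fin hgamma mD D0 mf f_argmin nua cS
      rho0M cS' coS' S'S S'0 S'1 x01 mG SG S'G S'q delta0 delta1 (ltW eps0) qdelta.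
    have -> : gamma (excess p eps (supp nu) `&` (setT `*` G)) = m G.
      rewrite mE'; congr (gamma _); apply/seteqP; split => z /=.
        by move=> [Ez [_ Gz]].
      by move=> [Gz Ez].
    have nuG : (nu G \is a fin_num)%E by exact: fin_num_measure.
    have mG_fin : (m G \is a fin_num)%E.
      rewrite ge0_fin_numE//; apply: le_lt_trans m_lty.
      by apply: le_measure; rewrite ?inE.
    rewrite -(fineK nuG) -(fineK mG_fin) -!EFinM !lee_fin => h.
    rewrite (_ : kappa * _ * _ =
      (M + eucl_norm y0 + 1) `^ p * delta * fine (nu G) / eps).
      by rewrite ler_pdivlMr// mulrC.
    by rewrite /kappa; field; rewrite gt_eqF.
  have half e : e ^+ 2 = 1 -> m (phi e @` `[-1, 1]) = 0%E.
    move=> e1; have [phiN1 phi1 phi_ne] := phi_psi e e1.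
    have eN1 : (- e) ^+ 2 = 1 by rewrite sqrrN.
    apply: (half_loop_null m_lty kappa0 nua cS (phi_cont e e1)
      (phi_cont _ eN1) _ _ _ phiN1 phi1 phi_ne removal).
    - exact: subset_trans (phiG e e1) hGamma.
    - exact: subset_trans (phiG _ eN1) hGamma.
    - by move=> s t; exact: phi_inj.
  have mhalf e : e ^+ 2 = 1 -> measurable (phi e @` `[-1, 1] : set (borel R d)).
    by move=> e1; apply: closed_borel; apply: closed_phi_itv => //; exact: phi_cont.
  have e1 : (1 : R) ^+ 2 = 1 by rewrite expr1n.
  have eN1 : (- 1 : R) ^+ 2 = 1 by rewrite sqrrN expr1n.
  have -> : gamma (excess p eps (supp nu) `&` (setT `*` Gamma)) = m Gamma.
    rewrite mE'; congr (gamma _); apply/seteqP; split => z /=.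
      by move=> [Ez [_ Gz]].
    by move=> [Gz Ez].
  apply/eqP; rewrite eq_le measure_ge0 andbT.
  apply: (@le_trans _ _ (m (phi 1 @` `[-1, 1] `|` phi (-1) @` `[-1, 1]))).
    apply: le_measure; rewrite ?inE//; first by apply: measurableU; exact: mhalf.
    move=> y /Gphi[e [/eqP]]; rewrite sqrf_eq1.
    by move=> /orP[] /eqP -> y1; [left|right].
  apply: le_trans (measureU2 _ (mhalf _ e1) (mhalf _ eN1)) _.
  by rewrite [X in (X + _)%E](half _ e1) [X in (_ + X)%E](half _ eN1) adde0.
pose N n := excess p n.+1%:R^-1 (supp nu) `&` (setT `*` Gamma).
have N0 : gamma.-negligible (\bigcup_n N n).
  apply: negligible_bigcup => n; apply/negligibleP.
    apply: measurableI; first exact: measurable_excess.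
    exact: measurableX.
  by apply: null; rewrite invr_gt0.
have aeN : {ae gamma, forall z, ~ (\bigcup_n N n) z}.
  by apply: negligibleS N0 => z /= /contrapT.
apply: filterS2 (ae_coupling_snd hgamma.1 (ae_supp nu)) aeN => z Sz Nz Gz.
apply/eqP; rewrite eq_le dist_set_le// andbT leNgt; apply/negP => lt_dist.
have lt_pow : dist_set z.1 (supp nu) `^ p < eucl_dist z.1 z.2 `^ p.
  apply: gt0_ltr_powR => //; first exact: lt_le_trans hp.
    by rewrite nnegrE dist_set_ge0.
  by rewrite nnegrE eucl_dist_ge0.
apply: Nz; pose e := eucl_dist z.1 z.2 `^ p - dist_set z.1 (supp nu) `^ p.
have e0 : 0 < e by rewrite subr_gt0.
exists (Num.bound e^-1) => //; split; last by split.
by rewrite /excess/= -lerBrDl -/e ltW// invr_boundS_lt.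
Qed.
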